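(* The FIFO Stack-Up problem can be solved in time $O(n^2\cdot k^m)$.
   Context: FIFO Stack-Up problem. An instance consists of a list $Q=(q_1,\ldots,q_k)$ of $k$ sequences of pairwise distinct bins, a pallet symbol ${\it plt}(b)$ (a positive integer) for every bin $b$, and a positive integer $p$. Standing assumption: every pallet symbol that occurs is carried by at least two bins. $n$ is the total number of bins and $m$ the number of distinct pallet symbols (pallets). A configuration is a tuple $(i_1,\ldots,i_k)$ with $0\le i_j\le |q_j|$, meaning that the first $i_j$ bins of $q_j$ have been removed. A pallet $t$ is open in configuration $(i_1,\ldots,i_k)$ if there are indices $j,\ell$ such that some bin for $t$ is at a position $\le i_j$ in $q_j$ and some bin for $t$ is at a position $> i_\ell$ in $q_\ell$. A transformation step removes the bin at position $i_j+1$ of some sequence $q_j$ (with $i_j<|q_j|$). A processing of $Q$ is a sequence of transformation steps from $(0,\ldots,0)$ to $(|q_1|,\ldots,|q_k|)$. The question is whether there is a processing of $Q$ such that in each configuration during the processing at most $p$ pallets are open. *)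

(* Defs.v *)
From mathcomp Require Import all_boot.

Set Implicit Arguments.
Unset Strict Implicit.
Unset Printing Implicit Defensive.

Section FifoStackUp.

Variables (B : eqType) (k : nat) (Q : k.-tuple (seq B)) (plt : B -> nat).

Definition bins : seq B := flatten Q.

Definition pallets : seq nat := undup (map plt bins).

Definition nb_bins : nat := size bins.

Definition nb_pallets : nat := size pallets.

Definition fifo_instance (p : nat) : Prop :=
  [/\ uniq bins,
      {in bins, forall b, 0 < plt b},
      {in pallets, forall t, 1 < count (fun b => plt b == t) bins}
    & 0 < p].

(* A configuration is a [k.-tuple nat].  Its bounds [tnth c j <= size (tnth Q j)]
   are not part of the type: they hold along every processing, because
   [transformation_step] only removes a bin that exists. *)

(* [take i q] holds the bins of q at the (1-based) positions <= i, and
   [drop i q] those at the positions > i. *)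
Definition open_pallet (c : k.-tuple nat) (t : nat) : bool :=
  [exists j : 'I_k, has (fun b => plt b == t) (take (tnth c j) (tnth Q j))] &&
  [exists l : 'I_k, has (fun b => plt b == t) (drop (tnth c l) (tnth Q l))].

Definition nb_open (c : k.-tuple nat) : nat := count (open_pallet c) pallets.

Definition initial_config : k.-tuple nat := [tuple 0 | j < k].

Definition final_config : k.-tuple nat := [tuple size (tnth Q j) | j < k].

Definition transformation_step : rel (k.-tuple nat) := fun c c' =>
  [exists j : 'I_k, (tnth c j < size (tnth Q j)) &&
                    (c' == [tuple tnth c l + (l == j) | l < k])].

(* [s] lists the configurations reached after the initial one. *)
Definition processing (s : seq (k.-tuple nat)) : bool :=
  path transformation_step initial_config s &&
  (last initial_config s == final_config).

Definition fifo_stack_up (p : nat) : Prop :=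
  exists2 s, processing s & all (fun c => nb_open c <= p) (initial_config :: s).

(* k, p, then every sequence as its length followed by the pallet symbols of
   its bins.  The names of the bins carry no further information, bins being
   pairwise distinct. *)
Definition encode (p : nat) : seq nat :=
  k :: p :: flatten [seq size q :: map plt q | q : seq B <- Q].

End FifoStackUp.

(* Unit-cost random access machine: registers are addressed by constants of
   the program; the memory is reached only through an address held in a
   register.  There is no multiplication: with it, unit-cost time would no longer be realistic. *)
Inductive instr : Type :=
| RConst (r v : nat)
| RAdd (r a b : nat)
| RSub (r a b : nat)
| RLoad (r a : nat)
| RStore (a r : nat)
| RJump (l : nat)
| RJumpEq (a b l : nat)
| RJumpLt (a b l : nat).

Definition program : Type := seq instr.

Record state : Type := State { pc : nat; reg : nat -> nat; mem : nat -> nat }.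

Definition update (f : nat -> nat) (x v : nat) : nat -> nat :=
  fun y => if y == x then v else f y.

Definition exec_instr (i : instr) (s : state) : state :=
  let: State pc R M := s in
  match i with
  | RConst r v => State pc.+1 (update R r v) M
  | RAdd r a b => State pc.+1 (update R r (R a + R b)) M
  | RSub r a b => State pc.+1 (update R r (R a - R b)) M
  | RLoad r a => State pc.+1 (update R r (M (R a))) M
  | RStore a r => State pc.+1 R (update M (R a) (R r))
  | RJump l => State l R M
  | RJumpEq a b l => State (if R a == R b then l else pc.+1) R M
  | RJumpLt a b l => State (if R a < R b then l else pc.+1) R M
  end.

(* The machine halts when the program counter leaves the program. *)
Definition halted (P : program) (s : state) : bool := size P <= pc s.

Definition machine_step (P : program) (s : state) : state :=
  if halted P s then s else exec_instr (nth (RJump 0) P (pc s)) s.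

(* The input occupies the memory from address 0 on; all the other cells and
   all the registers start at 0. *)
Definition initial_state (w : seq nat) : state :=
  State 0 (fun _ => 0) (fun x => nth 0 w x).

Definition run (P : program) (w : seq nat) (t : nat) : state :=
  iter t (machine_step P) (initial_state w).

(* A halted machine no longer moves, so its state at time t is the final one if
   it halts within t instructions.  Register 0 holds the answer to A. *)
Definition decides_within (P : program) (w : seq nat) (A : Prop) (t : nat) :
    Prop :=
  halted P (run P w t) /\
  (A /\ reg (run P w t) 0 = 1 \/ ~ A /\ reg (run P w t) 0 = 0).

(* Main.v *)
Require Import Defs.
From mathcomp Require Import all_boot.
From mathcomp Require Import zify.

(* Removing a bin of an open pallet never hurts: any processing can be
   rearranged to do so first, and no configuration gains an open pallet.
   Hence a processing is determined by the sequences chosen when no first bin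
   belongs to an open pallet.  Each such choice opens a new pallet, so there
   are at most m of them, and the machine tries the K^m vectors of choices with
   an m-digit counter in base K, where K <= min(k, n) is the number of nonempty
   sequences.  One vector is played in time O(n K + n) = O(n^2), since a pallet
   counter and a flag per pallet decide in constant time whether a bin belongs
   to an open pallet and how many pallets are open. *)

Set Implicit Arguments.
Unset Strict Implicit.
Unset Printing Implicit Defensive.

(** * A structured language compiled to the machine *)

(** The bound concerns a concrete program for a machine without multiplication or division, so the
    search works by additions and table look-ups alone: a vector of choices is an array of digits,
    and its value as a number exists only in the proof. Two quantities could spoil the bound. Empty
    sequences may make k far larger than n; one play costs about n K, and counting only nonempty
    sequences in K keeps this below n^2, while the single pass over all k lengths is paid by k <=
    k^m, since m > 0 as soon as there is a bin. Pallet symbols are integers with no bound in terms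
    of n, so a table indexed by symbols is never swept: it is reset by walking over the bins.
    Without bins the expression n^2 k^m is 0 although the machine still has to read its input; such
    instances are covered by termination alone. *)

Inductive cmd : Type :=
| Skip
| Cst (x v : nat)
| Add (x a b : nat)
| Sub (x a b : nat)
| In (x a : nat)
| Ld (x c a : nat)
| St (c a x : nat)
| Seq (c1 c2 : cmd)
| If (a b : nat) (c1 c2 : cmd)
| While (a b : nat) (c : cmd).

(* Variable x lives in register x + 2, registers 0 and 1 being scratch.  Cell j
   of array c < 8 lives at address E + 8 j + c, where E is the end of the input
   and is kept in variable 0: the arrays are unbounded and never overlap. *)
Definition address (c a : nat) : program :=
  [:: RAdd 0 a.+2 a.+2; RAdd 0 0 0; RAdd 0 0 0; RAdd 0 0 2;
      RConst 1 c; RAdd 0 0 1].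

(** Jump targets are absolute, hence the offset [o]. The only conditional jump used is taken when
    the comparison holds, so the else branch is laid out first. A true comparison therefore adds one
    instruction and a false one two, counting the jump over the other branch. *)
Fixpoint compile (o : nat) (c : cmd) : program :=
  match c with
  | Skip => [::]
  | Cst x v => [:: RConst x.+2 v]
  | Add x a b => [:: RAdd x.+2 a.+2 b.+2]
  | Sub x a b => [:: RSub x.+2 a.+2 b.+2]
  | In x a => [:: RLoad x.+2 a.+2]
  | Ld x c a => address c a ++ [:: RLoad x.+2 0]
  | St c a x => address c a ++ [:: RStore 0 x.+2]
  | Seq c1 c2 =>
      let p := compile o c1 in p ++ compile (o + size p) c2
  | If a b c1 c2 =>
      let p2 := compile o.+1 c2 in
      let o1 := (o.+1 + size p2).+1 in
      let p1 := compile o1 c1 in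
      RJumpLt a.+2 b.+2 o1 :: p2 ++ RJump (o1 + size p1) :: p1
  | While a b c =>
      let p := compile o.+2 c in
      RJumpLt a.+2 b.+2 o.+2 :: RJump (o.+2 + size p).+1 :: p ++ [:: RJump o]
  end.

Record store : Type := Store { var : nat -> nat; arr : nat -> nat -> nat }.

Definition set_var (s : store) (x v : nat) : store :=
  Store (update (var s) x v) (arr s).

Definition set_arr (s : store) (c j v : nat) : store :=
  Store (var s)
    (fun c' => if c' == c then update (arr s c) j v else arr s c').

(** * Cost semantics and correctness of the compiler *)

Section Semantics.

Variable w : seq nat.

(* The cost in the third argument counts machine instructions.  The premises of
   [ExIn], [ExLd] and [ExSt] keep raw accesses inside the input and array
   accesses outside it. *)
Inductive exec : cmd -> store -> nat -> store -> Prop :=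
| ExSkip s : exec Skip s 0 s
| ExCst s x v : exec (Cst x v) s 1 (set_var s x v)
| ExAdd s x a b : exec (Add x a b) s 1 (set_var s x (var s a + var s b))
| ExSub s x a b : exec (Sub x a b) s 1 (set_var s x (var s a - var s b))
| ExIn s x a : var s a < size w ->
    exec (In x a) s 1 (set_var s x (nth 0 w (var s a)))
| ExLd s x c a : var s 0 = size w -> c < 8 ->
    exec (Ld x c a) s 7 (set_var s x (arr s c (var s a)))
| ExSt s c a x : var s 0 = size w -> c < 8 ->
    exec (St c a x) s 7 (set_arr s c (var s a) (var s x))
| ExSeq s s1 s2 c1 c2 t1 t2 :
    exec c1 s t1 s1 -> exec c2 s1 t2 s2 -> exec (Seq c1 c2) s (t1 + t2) s2
| ExIfT s s' a b c1 c2 t : var s a < var s b ->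
    exec c1 s t s' -> exec (If a b c1 c2) s t.+1 s'
| ExIfF s s' a b c1 c2 t : var s b <= var s a ->
    exec c2 s t s' -> exec (If a b c1 c2) s t.+2 s'
| ExWhileT s s1 s2 a b c t1 t2 : var s a < var s b ->
    exec c s t1 s1 -> exec (While a b c) s1 t2 s2 ->
    exec (While a b c) s (t1 + t2).+2 s2
| ExWhileF s a b c : var s b <= var s a -> exec (While a b c) s 2 s.

Definition rep (s : store) (R M : nat -> nat) : Prop :=
  [/\ forall x, R x.+2 = var s x,
      forall a, a < size w -> M a = nth 0 w a
    & forall c j, c < 8 -> M (size w + 8 * j + c) = arr s c j].

Definition code_at (P : program) (o : nat) (p : program) : Prop :=
  exists pre post, P = pre ++ p ++ post /\ size pre = o.

Lemma code_at_cat P o p1 p2 :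
  code_at P o (p1 ++ p2) -> code_at P o p1 /\ code_at P (o + size p1) p2.
Proof.
move=> [pre [post [-> <-]]]; split.
  by exists pre, (p2 ++ post); rewrite -!catA.
by exists (pre ++ p1), post; rewrite size_cat !catA.
Qed.

Lemma code_at_cons P o i p :
  code_at P o (i :: p) -> code_at P o.+1 p.
Proof. by rewrite -cat1s -addn1 => /code_at_cat[]. Qed.

Lemma machine_step_at P o i p R M : code_at P o (i :: p) ->
  machine_step P (State o R M) = exec_instr i (State o R M).
Proof.
move=> [pre [post [-> <-]]]; rewrite /machine_step /halted /=.
rewrite size_cat /= addnS leqNgt ltnS leq_addr /=.
by rewrite nth_cat ltnn subnn.
Qed.

Lemma iter_machine_step P o i p R M t : code_at P o (i :: p) ->
  iter t.+1 (machine_step P) (State o R M)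
    = iter t (machine_step P) (exec_instr i (State o R M)).
Proof. by move=> /machine_step_at step; rewrite iterSr step. Qed.

Lemma rep_set_var s R M x v : rep s R M -> rep (set_var s x v) (update R x.+2 v) M.
Proof. by case=> vE wE aE; split=> // y; rewrite /update /= eqSS vE. Qed.

Lemma iter_address P o c a p s R M t : code_at P o (address c a ++ p) ->
    var s 0 = size w -> rep s R M ->
  exists R', [/\ iter (t + 6) (machine_step P) (State o R M)
        = iter t (machine_step P) (State (o + 6) R' M),
    rep s R' M & R' 0 = size w + 8 * var s a + c].
Proof.
move=> code s0 [vE wE aE].
have [c1 _] := code_at_cat code; have c2 := code_at_cons c1.
have c3 := code_at_cons c2; have c4 := code_at_cons c3.
have c5 := code_at_cons c4; have c6 := code_at_cons c5.
rewrite !addnS addn0.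
rewrite (iter_machine_step _ _ _ c1) (iter_machine_step _ _ _ c2).
rewrite (iter_machine_step _ _ _ c3) (iter_machine_step _ _ _ c4).
rewrite (iter_machine_step _ _ _ c5) (iter_machine_step _ _ _ c6) /=.
eexists; split; first by rewrite addn0.
- by split.
- by rewrite /update /= !vE s0; lia.
Qed.

(** The induction is on the execution, not on the command, because a loop runs its own code again.
    The code may sit anywhere in [P], so that the hypotheses apply to subprograms at their own
    offsets. *)
Lemma compile_correct c s t s' : exec c s t s' ->
  forall P o R M, code_at P o (compile o c) -> rep s R M ->
  exists R' M', iter t (machine_step P) (State o R M)
      = State (o + size (compile o c)) R' M' /\ rep s' R' M'.
Proof.
elim=> {c s t s'}.
- by move=> s P o R M _ sRM; exists R, M; rewrite addn0.
- move=> s x v P o R M code sRM; rewrite (iter_machine_step _ _ _ code) /= addn1.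
  by do 2!eexists; split=> //; apply: rep_set_var.
- move=> s x a b P o R M code sRM; rewrite (iter_machine_step _ _ _ code) /= addn1.
  do 2!eexists; split=> //; case: (sRM) => vE _ _.
  by rewrite !vE; apply: rep_set_var.
- move=> s x a b P o R M code sRM; rewrite (iter_machine_step _ _ _ code) /= addn1.
  do 2!eexists; split=> //; case: (sRM) => vE _ _.
  by rewrite !vE; apply: rep_set_var.
- move=> s x a lt_a P o R M code sRM.
  rewrite (iter_machine_step _ _ _ code) /= addn1.
  do 2!eexists; split=> //; case: (sRM) => vE wE _.
  by rewrite !vE wE //; apply: rep_set_var.
- move=> s x c a s0 c8 P o R M code sRM.
  have [R' [-> sR'M R'0]] := iter_address 1 code s0 sRM.
  have [_ code'] := code_at_cat code.
  rewrite (iter_machine_step _ _ _ code') /=; do 2!eexists; split.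
    by rewrite -addnS.
  case: (sR'M) => _ _ aE; rewrite R'0 aE //; exact: rep_set_var.
- move=> s c a x s0 c8 P o R M code sRM.
  have [R' [-> sR'M R'0]] := iter_address 1 code s0 sRM.
  have [_ code'] := code_at_cat code.
  rewrite (iter_machine_step _ _ _ code') /=; do 2!eexists; split.
    by rewrite -addnS.
  case: sR'M => vE wE aE; rewrite R'0 vE; split=> //.
    by move=> b b_lt; rewrite /update wE //; case: eqP => //; lia.
  (* As [c] and [c'] are below 8, an address past [size w] determines its array as a remainder
     modulo 8 and its index as a quotient. *)
  move=> c' j c'8; rewrite /set_arr /= /update.
  case: (eqVneq c' c) => [->|ne_c].
    have -> : (size w + 8 * j + c == size w + 8 * var s a + c) = (j == var s a).
      by lia.
    by case: eqP => // _; apply: aE.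
  by rewrite aE //; case: eqP => //; lia.
- move=> s s1 s2 c1 c2 t1 t2 _ IH1 _ IH2 P o R M code sRM.
  have [code1 code2] := code_at_cat code.
  have [R1 [M1 [run1 rep1]]] := IH1 _ _ _ _ code1 sRM.
  have [R2 [M2 [run2 rep2]]] := IH2 _ _ _ _ code2 rep1.
  exists R2, M2; rewrite addnC iterD run1 run2 size_cat addnA; split=> //.
- move=> s s' a b c1 c2 t lt_ab _ IH P o R M code sRM.
  have code0 := code; rewrite /= in code0; rewrite (iter_machine_step _ _ _ code0) /=.
  have [vE _ _] := sRM; rewrite !vE lt_ab.
  have [_ /code_at_cons code1] := code_at_cat (code_at_cons code0).
  have [R' [M' [-> rep']]] := IH _ _ _ _ code1 sRM.
  by exists R', M'; split=> //; congr State; rewrite size_cat /=; lia.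
- move=> s s' a b c1 c2 t le_ba _ IH P o R M code sRM.
  have code0 := code; rewrite /= in code0; rewrite (iter_machine_step _ _ _ code0) /=.
  have [vE _ _] := sRM; rewrite !vE ltnNge le_ba /=.
  have [code2 code1] := code_at_cat (code_at_cons code0).
  have [R' [M' [run' rep']]] := IH P _ _ _ code2 sRM.
  exists R', M'; split=> //; rewrite -iterS -add1n iterD run'.
  rewrite (iter_machine_step _ _ _ code1) /=.
  by congr State; rewrite size_cat /=; lia.
- move=> s s1 s2 a b c t1 t2 lt_ab _ IH1 _ IH2 P o R M code sRM.
  have [vE _ _] := sRM; have code0 := code; rewrite /= in code0.
  rewrite (iter_machine_step _ _ _ code0) /= !vE lt_ab.
  have [code1 code2] := code_at_cat (code_at_cons (code_at_cons code0)).
  have [R1 [M1 [run1 rep1]]] := IH1 _ _ _ _ code1 sRM.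
  rewrite -iterS -addnS addnC iterD run1 (iter_machine_step _ _ _ code2) /=.
  exact: IH2 _ _ _ _ code rep1.
- move=> s a b c le_ba P o R M /= code sRM; have [vE _ _] := sRM.
  have code1 := code_at_cons code.
  rewrite -!/(iter _.+1 _ _) /= (machine_step_at _ _ code) /=.
  rewrite !vE ltnNge le_ba (machine_step_at _ _ code1) /=.
  exists R, M; split=> //; congr State; rewrite size_cat /=; lia.
Qed.

End Semantics.

(** * Total correctness with time credits *)

Section Triples.

Variable w : seq nat.

Implicit Types (s : store) (T : nat) (Q : nat -> store -> Prop).

(* The postcondition receives the time left out of the credit [T].
   Credits are written constant first, so that they unify with [T.+1]. *)
Definition ev (c : cmd) s T Q : Prop :=
  exists t s', [/\ exec w c s t s', t <= T & Q (T - t) s'].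

Lemma ev_skip s T Q : Q T s -> ev Skip s T Q.
Proof. by move=> Qs; exists 0, s; rewrite subn0; split=> //; constructor. Qed.

Lemma ev_cst x v s T Q : Q T (set_var s x v) -> ev (Cst x v) s T.+1 Q.
Proof. by move=> Qs; exists 1, (set_var s x v); rewrite subn1; split=> //; constructor. Qed.

Lemma ev_add x a b s T Q :
  Q T (set_var s x (var s a + var s b)) -> ev (Add x a b) s T.+1 Q.
Proof. by move=> Qs; do 2!eexists; split; [constructor| |rewrite subn1]. Qed.

Lemma ev_sub x a b s T Q :
  Q T (set_var s x (var s a - var s b)) -> ev (Sub x a b) s T.+1 Q.
Proof. by move=> Qs; do 2!eexists; split; [constructor| |rewrite subn1]. Qed.

Lemma ev_in x a s T Q : var s a < size w ->
  Q T (set_var s x (nth 0 w (var s a))) -> ev (In x a) s T.+1 Q.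
Proof.
move=> lt_a Qs; do 2!eexists; split; [exact: ExIn| |] => //.
by rewrite subn1.
Qed.

Lemma ev_ld x c a s T Q : c < 8 -> var s 0 = size w ->
  Q T (set_var s x (arr s c (var s a))) -> ev (Ld x c a) s T.+4.+3 Q.
Proof.
move=> c8 s0 Qs; do 2!eexists; split; [exact: ExLd| |] => //.
by rewrite !subSS subn0.
Qed.

Lemma ev_st c a x s T Q : c < 8 -> var s 0 = size w ->
  Q T (set_arr s c (var s a) (var s x)) -> ev (St c a x) s T.+4.+3 Q.
Proof.
move=> c8 s0 Qs; do 2!eexists; split; [exact: ExSt| |] => //.
by rewrite !subSS subn0.
Qed.

Lemma ev_seq c1 c2 s T Q :
  ev c1 s T (fun T' s' => ev c2 s' T' Q) -> ev (Seq c1 c2) s T Q.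
Proof.
move=> [t1 [s1 [ex1 le1 [t2 [s2 [ex2 le2 Qs]]]]]].
exists (t1 + t2), s2; split; [exact: ExSeq ex1 ex2 | by lia |].
by rewrite subnDA.
Qed.

Lemma ev_if a b c1 c2 s T Q :
    (var s a < var s b -> ev c1 s T.+1 Q) ->
    (var s b <= var s a -> ev c2 s T Q) ->
  ev (If a b c1 c2) s T.+2 Q.
Proof.
move=> ev1 ev2; case: (ltnP (var s a) (var s b)) => [lt_ab|le_ba].
  have [t [s' [ex le Qs]]] := ev1 lt_ab; exists t.+1, s'.
  by split=> //; apply: ExIfT.
have [t [s' [ex le Qs]]] := ev2 le_ba; exists t.+2, s'.
by split=> //; apply: ExIfF.
Qed.

(** Forgets the credit left over by [c1] and gives [c2] a budget of its own, so that later goals do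
    not depend on the path taken through [c1]. *)
Lemma ev_cut (P Q : store -> Prop) c1 c2 s T T1 T2 :
    ev c1 s T1 (fun _ => P) -> (forall s', P s' -> ev c2 s' T2 (fun _ => Q)) ->
    T1 + T2 <= T -> ev (Seq c1 c2) s T (fun _ => Q).
Proof.
move=> [t1 [s1 [ex1 le1 /[swap] /[apply] [[t2 [s2 [ex2 le2 Qs]]]]]]] le.
by exists (t1 + t2), s2; split=> //; [exact: ExSeq ex1 ex2 | lia].
Qed.

Lemma ev_weaken (P Q : store -> Prop) c s T T1 :
  ev c s T1 (fun _ => P) -> (forall s', P s' -> Q s') -> T1 <= T ->
  ev c s T (fun _ => Q).
Proof.
move=> [t [s' [ex le Ps]]] PQ le_T; exists t, s'; split=> //; last exact: PQ.
exact: leq_trans le_T.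
Qed.

(* [r] bounds the number of remaining iterations. *)
Lemma ev_while (I : nat -> store -> Prop) (Q : store -> Prop) Tb a b c r s T :
    (forall r s, I r s -> var s a < var s b ->
       ev c s Tb (fun _ s' => exists2 r', r' < r & I r' s')) ->
    (forall r s, I r s -> var s b <= var s a -> Q s) ->
    I r s -> r * (Tb + 2) + 2 <= T ->
  ev (While a b c) s T (fun _ => Q).
Proof.
move=> body exit; elim/ltn_ind: r s T => r IH s T Is le_T.
case: (ltnP (var s a) (var s b)) => [lt_ab|le_ba]; last first.
  exists 2, s; split; [exact: ExWhileF | lia | exact: exit Is le_ba].
have [t1 [s1 [ex1 le1 [r1 lt_r Is1]]]] := body _ _ Is lt_ab.
have [t2 [s2 [ex2 le2 Qs]]] := IH r1 lt_r s1 _ Is1 (leqnn _).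
exists (t1 + t2).+2, s2; split=> //; first exact: ExWhileT ex1 ex2.
have := leq_mul2r (Tb + 2) r1.+1 r; rewrite lt_r orbT mulSn; lia.
Qed.

End Triples.

Ltac ev_step :=
  first [ apply: ev_seq | apply: ev_skip | apply: ev_cst | apply: ev_add
        | apply: ev_sub | apply: ev_ld => // | apply: ev_st => // ].

(** * Greedy processings *)

Section StackUp.

Variable p : nat.

Implicit Types (S : nat -> bool) (L : seq (seq nat)).

Definition head_at L x : nat := head 0 (nth [::] L x).
Definition start S t : nat -> bool := fun u => (u == t) || S u.
Definition pop L x : seq (seq nat) := set_nth [::] L x (behead (nth [::] L x)).
Definition open_set S L : seq nat := undup (filter S (flatten L)).
Definition nopen S L : nat := size (open_set S L).
Definition started_head S (q : seq nat) : bool :=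
  if q is t :: _ then S t else false.

(* [L] holds the pallet symbols of the bins left and [S] tells which pallets
   have been started; the next [f] removals are considered. *)
Fixpoint solvable f S L : Prop :=
  if f is f'.+1 then
    exists x, [/\ nth [::] L x != [::],
                  nopen (start S (head_at L x)) (pop L x) <= p
                & solvable f' (start S (head_at L x)) (pop L x)]
  else True.

(* [ds] lists the sequences to take from when no first bin is of an open pallet.
   A started pallet with a bin left is open, so flags of started pallets suffice. *)
Fixpoint greedy f (ds : seq nat) S L : bool :=
  if f is f'.+1 then
    let x := find (started_head S) L in
    if x < size L then
      (nopen (start S (head_at L x)) (pop L x) <= p) &&
      greedy f' ds (start S (head_at L x)) (pop L x)
    else if ds is d :: ds' then
      [&& nth [::] L d != [::],
          nopen (start S (head_at L d)) (pop L d) <= p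
        & greedy f' ds' (start S (head_at L d)) (pop L d)]
    else false
  else true.

Lemma eq_nopen S S' L : S =1 S' -> nopen S L = nopen S' L.
Proof. by move=> eS; rewrite /nopen /open_set (eq_filter eS). Qed.

Lemma eq_start S S' t : S =1 S' -> start S t =1 start S' t.
Proof. by move=> eS u; rewrite /start eS. Qed.

Lemma start_id S t : S t -> start S t =1 S.
Proof. by move=> St u; rewrite /start; case: eqP => // ->. Qed.

Lemma startC S t u : start (start S t) u =1 start (start S u) t.
Proof. by move=> v; rewrite /start orbCA. Qed.

Lemma eq_solvable f S S' L : S =1 S' -> solvable f S L -> solvable f S' L.
Proof.
elim: f S S' L => //= f IH S S' L eS [x [Lx le_p ok]]; exists x; split=> //.
  by rewrite -(eq_nopen _ (eq_start _ eS)).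
exact: IH (eq_start _ eS) ok.
Qed.

Lemma nth_nil_lt L x : nth [::] L x != [::] -> x < size L.
Proof. by case: leqP => // le_x; rewrite nth_default. Qed.

Lemma size_pop L x : nth [::] L x != [::] -> size (pop L x) = size L.
Proof. by move=> /nth_nil_lt lt_x; rewrite size_set_nth (maxn_idPr _). Qed.

Lemma nth_pop L x y : nth [::] (pop L x) y =
  if y == x then behead (nth [::] L x) else nth [::] L y.
Proof. by rewrite nth_set_nth /=. Qed.

Lemma popC L x y : x != y -> nth [::] L x != [::] -> nth [::] L y != [::] ->
  pop (pop L x) y = pop (pop L y) x.
Proof.
move=> ne_xy Lx Ly; apply: (@eq_from_nth _ [::]).
  by rewrite !size_pop // nth_pop; case: ifP ne_xy => // /eqP ->; rewrite eqxx.
move=> z _; rewrite !nth_pop.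
rewrite [y == x]eq_sym (negPf ne_xy).
by have [->|//] := eqVneq z x; rewrite (negPf ne_xy).
Qed.

Lemma perm_pop L x : nth [::] L x != [::] ->
  perm_eq (flatten L) (head_at L x :: flatten (pop L x)).
Proof.
move=> Lx; have lt_x := nth_nil_lt Lx.
rewrite /pop set_nthE lt_x -{1}(cat_take_drop x L) (drop_nth [::] lt_x).
rewrite /head_at; case: (nth [::] L x) Lx => //= t q _.
by apply/permP => a; rewrite !flatten_cat /= !count_cat /= !count_cat; lia.
Qed.

Lemma mem_pop L x t : nth [::] L x != [::] ->
  (t \in flatten L) = (t == head_at L x) || (t \in flatten (pop L x)).
Proof. by move=> /perm_pop/perm_mem ->; rewrite in_cons. Qed.

Lemma sub_pop L x : nth [::] L x != [::] ->
  {subset flatten (pop L x) <= flatten L}.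
Proof. by move=> Lx t t_in; rewrite (mem_pop t Lx) t_in orbT. Qed.

Lemma mem_open_set S L t : (t \in open_set S L) = S t && (t \in flatten L).
Proof. by rewrite mem_undup mem_filter. Qed.

Lemma nopen_start S L t : t \in flatten L ->
  nopen (start S t) L = nopen S L + ~~ S t.
Proof.
move=> t_in; case: (boolP (S t)) => St.
  by rewrite addn0; apply: eq_nopen; apply: start_id.
rewrite addn1; have -> : (nopen S L).+1 = size (t :: open_set S L) by [].
apply/perm_size/uniq_perm; first exact: undup_uniq.
  by rewrite /= undup_uniq mem_open_set (negPf St).
move=> u; rewrite in_cons !mem_open_set /start.
by case: eqVneq => [->|].
Qed.

(** The update rule of the counter [vcnt]. Marking the pallet first adds one if it is new; removing
    the bin then closes it exactly when none of its bins is left. In this order the subtraction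
    never truncates, the marked pallet being counted. *)
Lemma nopen_pop S L x : nth [::] L x != [::] ->
  nopen (start S (head_at L x)) (pop L x)
    = nopen S L + ~~ S (head_at L x) - (head_at L x \notin flatten (pop L x)).
Proof.
move=> Lx; have Lt := mem_pop (head_at L x) Lx; rewrite eqxx in Lt.
rewrite -nopen_start // {Lt}; set t := head_at L x; set S' := start S t.
have S't : S' t by rewrite /S' /start eqxx.
case: (boolP (t \in flatten (pop L x))) => t_in /=.
  rewrite subn0; apply/perm_size/uniq_perm; rewrite ?undup_uniq // => u.
  rewrite !mem_open_set (mem_pop _ Lx) -/t; case: eqVneq => [->|//].
  by rewrite t_in.
suff -> : nopen S' L = size (t :: open_set S' (pop L x)) by rewrite /= subn1.
apply/perm_size/uniq_perm; rewrite ?undup_uniq //=.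
  by rewrite mem_open_set (negPf t_in) andbF undup_uniq.
move=> u; rewrite in_cons !mem_open_set (mem_pop _ Lx) -/t.
by case: eqVneq => [->|//]; rewrite S't.
Qed.

Lemma nopen_subset S S' L L' :
    (forall t, S t -> t \in flatten L -> S' t && (t \in flatten L')) ->
  nopen S L <= nopen S' L'.
Proof.
move=> sub; apply: uniq_leq_size; first exact: undup_uniq.
by move=> t; rewrite !mem_open_set => /andP[St /(sub t St)].
Qed.

(* The exchange argument: postponed removals of the first bin of [x] can be
   brought forward, its pallet being open all the while. *)
Lemma solvable_started f S L x : nth [::] L x != [::] -> S (head_at L x) ->
    nopen S L <= p -> solvable f.+1 S L ->
  nopen (start S (head_at L x)) (pop L x) <= p /\
  solvable f (start S (head_at L x)) (pop L x).
Proof.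
elim: f S L => [|f IH] S L Lx Sx le_p.
all: have nopen_x : nopen (start S (head_at L x)) (pop L x) <= p
  by rewrite (eq_nopen _ (start_id Sx)); apply: leq_trans le_p;
     apply: nopen_subset => t -> /(sub_pop Lx) ->.
  (* With a single removal considered, that of [x] replaces whichever one was planned; [x] need not
     occur in the plan. *)
  by split.
move=> [y [Ly le_py ok]]; split=> //.
have [eq_xy | ne_xy] := eqVneq x y.
  by subst y.
have nxy : nth [::] (pop L y) x = nth [::] L x.
  by rewrite nth_pop (negPf ne_xy).
have nyx : nth [::] (pop L x) y = nth [::] L y.
  by rewrite nth_pop eq_sym (negPf ne_xy).
have hxy : head_at (pop L y) x = head_at L x by rewrite /head_at nxy.
have hyx : head_at (pop L x) y = head_at L y by rewrite /head_at nyx.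
(* The plan starts with [y]. The induction hypothesis brings [x] to the front of what follows, and
   the two removals are then swapped. *)
have [] := IH (start S (head_at L y)) (pop L y) _ _ le_py ok.
- by rewrite nxy.
- by rewrite hxy /start Sx orbT.
rewrite hxy => le_pxy okxy; exists y; rewrite nyx hyx popC //; split=> //.
  by rewrite (eq_nopen _ (startC _ _ _)).
exact: eq_solvable (startC _ _ _) okxy.
Qed.

Lemma find_started S L : let x := find (started_head S) L in
  x < size L -> nth [::] L x != [::] /\ S (head_at L x).
Proof.
move=> /= lt_x; have := nth_find [::] (_ : has (started_head S) L).
by rewrite has_find lt_x /head_at => /(_ isT); case: nth.
Qed.

Lemma greedy_sound f ds S L : greedy f ds S L -> solvable f S L.
Proof.
elim: f ds S L => //= f IH ds S L.
case: ltnP => [lt_x /andP[le_p /IH ok]|_].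
  by exists (find (started_head S) L); split=> //; case: (find_started lt_x).
case: ds => // d ds /and3P[Ld le_p /IH ok]; by exists d.
Qed.

(* Bounds the number of choices still to be made. *)
Definition nfresh S L : nat := nopen (fun t => ~~ S t) L.

Lemma leq_nfresh_pop S L x : nth [::] L x != [::] ->
  nfresh (start S (head_at L x)) (pop L x) <= nfresh S L.
Proof.
move=> Lx; apply: nopen_subset => t; rewrite negb_or => /andP[_ ->].
by move=> /(sub_pop Lx) ->.
Qed.

Lemma ltn_nfresh_pop S L x : nth [::] L x != [::] -> ~~ S (head_at L x) ->
  nfresh (start S (head_at L x)) (pop L x) < nfresh S L.
Proof.
move=> Lx Sx; set S' := start _ _.
rewrite /nfresh /nopen.
have -> : (size (open_set (fun t => ~~ S' t) (pop L x))).+1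
  = size (head_at L x :: open_set (fun t => ~~ S' t) (pop L x)) by [].
apply: uniq_leq_size.
  by rewrite /= undup_uniq mem_open_set /S' /start eqxx.
move=> t; rewrite in_cons !mem_open_set (mem_pop t Lx).
case: eqVneq => [-> | _] /=; first by rewrite Sx.
by rewrite negb_or => /andP[/andP[_ ->] ->].
Qed.

(** A started first bin is brought forward by the exchange argument and spends no choice. Otherwise
    the plan removes a bin of a new pallet, and the choice is paid for by the drop of [nfresh]. The
    length is exactly [u] because the machine enumerates vectors of a fixed length. *)
Lemma greedy_complete f S L u : solvable f S L -> nopen S L <= p ->
    nfresh S L <= u -> (0 < u -> 0 < size L) ->
  exists ds, [/\ size ds = u, all (fun d => d < size L) ds & greedy f ds S L].
Proof.
elim: f S L u => [|f IH] S L u ok le_p le_u u_gt0.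
  (* Choices never made are padded with the index 0, which has to be a legal digit: hence the
     hypothesis that [L] is nonempty when [u] is positive. *)
  exists (nseq u 0); split=> //; first by rewrite size_nseq.
  by rewrite all_nseq; case: u u_gt0 {le_u} => //= u ->.
case: (ltnP (find (started_head S) L) (size L)) => [lt_x|].
  set x := find _ _ in lt_x.
  have [Lx Sx] := find_started lt_x; rewrite -/x in Lx Sx.
  have [le_px okx] := solvable_started Lx Sx le_p ok.
  have [||ds [sz_ds ds_lt ds_ok]] := IH _ _ u okx le_px.
  - exact: leq_trans (leq_nfresh_pop S Lx) le_u.
  - by rewrite size_pop.
  exists ds; split=> //; first by rewrite -(size_pop Lx).
  by rewrite /= -/x lt_x le_px.
move=> no_x; case: ok => x [Lx le_px okx].
have Sx : ~~ S (head_at L x).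
  apply: contraL no_x => Sx; rewrite -ltnNge -has_find.
  apply/hasP; exists (nth [::] L x); first exact: mem_nth (nth_nil_lt Lx).
  by move: Lx Sx; rewrite /head_at; case: nth.
have := ltn_nfresh_pop Lx Sx; case: u le_u u_gt0 => [|u] le_u _ lt_u.
  by move: lt_u; rewrite ltnNge (leq_trans le_u).
have [||ds [sz_ds ds_lt ds_ok]] := IH _ _ u okx le_px.
- by rewrite -ltnS (leq_trans lt_u).
- by rewrite size_pop // (leq_ltn_trans _ (nth_nil_lt Lx)).
exists (x :: ds); rewrite /= sz_ds nth_nil_lt //=; split=> //.
  by rewrite -(size_pop Lx).
by rewrite ltnNge no_x /= Lx le_px.
Qed.

End StackUp.

(** * Empty sequences can be discarded *)

Definition nonempty (q : seq nat) : bool := q != [::].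

Lemma flatten_nonempty L : flatten (filter nonempty L) = flatten L.
Proof. by elim: L => //= -[|t q] L IH /=; rewrite IH. Qed.

Lemma filter_catE (T : Type) (x0 : T) (a : pred T) s s1 z s2 :
    filter a s = s1 ++ z :: s2 ->
  exists y, [/\ y < size s, nth x0 s y = z, filter a (take y s) = s1
    & filter a (drop y.+1 s) = s2].
Proof.
elim: s s1 => [|u s IH] [|v s1] //=; case: ifP => au.
- by case=> <- <-; exists 0; rewrite /= drop0.
- by move=> /(IH [::])[y [? ? e ?]]; exists y.+1; rewrite /= au.
- by case=> <- /IH[y [? ? e ?]]; exists y.+1; rewrite /= au e.
- by move=> /(IH (v :: s1))[y [? ? e ?]]; exists y.+1; rewrite /= au.
Qed.

Lemma popE L x : x < size L ->
  pop L x = take x L ++ behead (nth [::] L x) :: drop x.+1 L.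
Proof. by move=> lt_x; rewrite /pop set_nthE lt_x. Qed.

(** Two lists with the same nonempty members are compared, rather than a list and its filtered form,
    because a removal may empty a sequence and [pop] keeps it in place: filtered lists are not
    stable under [pop]. *)
Lemma filter_solvable p f S L L' : filter nonempty L = filter nonempty L' ->
  solvable p f S L -> solvable p f S L'.
Proof.
elim: f S L L' => //= f IH S L L' eLL' [x [Lx le_p ok]].
have lt_x := nth_nil_lt Lx.
have [|y [lt_y L'y take_y drop_y]] := @filter_catE _ [::] nonempty L'
    (filter nonempty (take x L)) (nth [::] L x) (filter nonempty (drop x.+1 L)).
  rewrite -eLL' -{1}(cat_take_drop x L) (drop_nth [::] lt_x) filter_cat /=.
  by rewrite (Lx : nonempty _).
have ePop : filter nonempty (pop L x) = filter nonempty (pop L' y).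
  by rewrite !popE // !filter_cat /= L'y take_y drop_y.
exists y; rewrite /head_at L'y; split=> //; last exact: IH ePop ok.
by move: le_p; rewrite /nopen /open_set -flatten_nonempty ePop flatten_nonempty.
Qed.

Lemma solvable_nonempty p f S L :
  solvable p f S L <-> solvable p f S (filter nonempty L).
Proof. by split; apply: filter_solvable; rewrite filter_id. Qed.

(** * From configurations to lists of remaining symbols *)

Section Configurations.

Variables (B : eqType) (k : nat) (Q : k.-tuple (seq B)) (plt : B -> nat).

Implicit Types c : k.-tuple nat.

Definition rest c : seq (seq nat) :=
  [seq map plt (drop (tnth c j) (tnth Q j)) | j <- enum 'I_k].

Definition started c (t : nat) : bool :=
  [exists j : 'I_k, has (fun b => plt b == t) (take (tnth c j) (tnth Q j))].

Definition advance c (j : 'I_k) : k.-tuple nat :=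
  [tuple tnth c l + (l == j) | l < k].

Lemma size_rest c : size (rest c) = k.
Proof. by rewrite size_map size_enum_ord. Qed.

Lemma nth_rest c (j : 'I_k) :
  nth [::] (rest c) j = map plt (drop (tnth c j) (tnth Q j)).
Proof. by rewrite (nth_map j) ?size_enum_ord // nth_ord_enum. Qed.

Lemma nth_rest_nil c (j : 'I_k) :
  (nth [::] (rest c) j != [::]) = (tnth c j < size (tnth Q j)).
Proof.
by rewrite nth_rest -size_eq0 size_map size_drop subn_eq0 -ltnNge.
Qed.

Lemma head_rest c (j : 'I_k) : tnth c j < size (tnth Q j) ->
  exists2 b, drop (tnth c j) (tnth Q j) = b :: drop (tnth c j).+1 (tnth Q j)
    & head_at (rest c) j = plt b /\ take (tnth c j).+1 (tnth Q j)
        = rcons (take (tnth c j) (tnth Q j)) b.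
Proof.
rewrite /head_at nth_rest; case: (tnth Q j) => // b0 q lt_c.
exists (nth b0 (b0 :: q) (tnth c j)); first by rewrite -drop_nth.
by split; [rewrite (drop_nth b0 lt_c) | apply: take_nth].
Qed.

Lemma rest_advance c j : tnth c j < size (tnth Q j) ->
  rest (advance c j) = pop (rest c) j.
Proof.
move=> lt_c; apply: (@eq_from_nth _ [::]).
  by rewrite size_pop ?nth_rest_nil // !size_rest.
move=> i; rewrite size_rest => lt_i; rewrite nth_pop.
rewrite (nth_rest (advance c j) (Ordinal lt_i)) tnth_mktuple.
rewrite (nth_rest c j) -val_eqE /=.
have [eq_ij|_] := eqVneq i j; last by rewrite addn0 (nth_rest c (Ordinal lt_i)).
have -> : Ordinal lt_i = j by apply: val_inj.
by have [b -> _] := head_rest lt_c; rewrite addn1.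
Qed.

Lemma started_advance c j : tnth c j < size (tnth Q j) ->
  started (advance c j) =1 start (started c) (head_at (rest c) j).
Proof.
move=> lt_c t; have [b _ [-> take_b]] := head_rest lt_c.
rewrite /start; apply/existsP/orP => [[i]|[/eqP ->|/existsP[i has_i]]].
- rewrite tnth_mktuple; have [->|_] := eqVneq i j.
    rewrite addn1 take_b has_rcons eq_sym => /orP[|has_j]; first by left.
    by right; apply/existsP; exists j.
  by rewrite addn0 => has_i; right; apply/existsP; exists i.
- by exists j; rewrite tnth_mktuple eqxx addn1 take_b has_rcons eqxx.
exists i; rewrite tnth_mktuple; have [eij|_] := eqVneq i j; last by rewrite addn0.
by rewrite addn1 eij take_b has_rcons -eij has_i orbT.
Qed.

Lemma mem_rest c t : (t \in flatten (rest c)) =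
  [exists l : 'I_k, has (fun b => plt b == t) (drop (tnth c l) (tnth Q l))].
Proof.
apply/flatten_mapP/existsP => [[l _ /mapP[b b_in ->]]|[l /hasP[b b_in /eqP <-]]].
  by exists l; apply/hasP; exists b.
by exists l; rewrite ?mem_enum // map_f.
Qed.

(** The two sides count in different lists, all pallets on the left and the symbols of the bins left
    on the right. They agree because an open pallet has a bin left. *)
Lemma nb_openE c : nb_open Q plt c = nopen (started c) (rest c).
Proof.
rewrite /nb_open -size_filter; apply/perm_size/uniq_perm.
- exact/filter_uniq/undup_uniq.
- exact: undup_uniq.
move=> t; rewrite mem_filter mem_open_set mem_rest.
rewrite -[open_pallet _ _ _ _]/(started c t && _).
case: (started c t) => //=; apply: andb_idr => /existsP[l /hasP[b b_in /eqP <-]].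
rewrite mem_undup map_f //; apply/flattenP; exists (tnth Q l); first exact: mem_tnth.
exact: mem_drop b_in.
Qed.

Lemma advance_step c j : tnth c j < size (tnth Q j) ->
  transformation_step Q c (advance c j).
Proof. by move=> lt_c; apply/existsP; exists j; rewrite lt_c eqxx. Qed.

(** When [f] is the number of bins left, [f] removals can only end in the final configuration, so
    [solvable] needs no condition on its end. *)
Lemma solvable_path p f c :
    (forall j, tnth c j <= size (tnth Q j)) -> size (flatten (rest c)) = f ->
  solvable p f (started c) (rest c) <->
  exists s, [/\ path (transformation_step Q) c s, last c s = final_config Q
              & all (fun c' => nb_open Q plt c' <= p) s].
Proof.
elim: f c => [|f IH] c le_c sz_c.
  split=> // _; exists [::]; split=> //=; apply: eq_from_tnth => j.
  rewrite tnth_mktuple; apply/eqP; rewrite eqn_leq le_c /= leqNgt.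
  apply/negP; rewrite -nth_rest_nil => Lj.
  by move: (perm_pop Lj); rewrite (size0nil sz_c) => /perm_size.
have le_advance j : tnth c j < size (tnth Q j) ->
    forall i, tnth (advance c j) i <= size (tnth Q i).
  by move=> lt_c i; rewrite tnth_mktuple; case: eqVneq => [->|_];
     rewrite ?addn1 ?addn0.
have sz_advance j : tnth c j < size (tnth Q j) ->
    size (flatten (rest (advance c j))) = f.
  move=> lt_c; have := perm_size (perm_pop (_ : nth [::] (rest c) j != [::])).
  by rewrite nth_rest_nil sz_c -rest_advance // => /(_ lt_c)[].
split=> [[x [Lx]]|[[|c' s]]].
- have lt_x := nth_nil_lt Lx; rewrite size_rest in lt_x.
  move: (Lx); rewrite -[x]/(val (Ordinal lt_x)) nth_rest_nil => lt_c.
  rewrite -(eq_nopen _ (started_advance lt_c)) -rest_advance // -nb_openE => le_p.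
  move=> /(@eq_solvable _ _ _ (started (advance c (Ordinal lt_x)))) ok.
  have /IH[||s [s_path s_last s_all]] := ok (fun t => esym (started_advance lt_c t)).
  + exact: le_advance.
  + exact: sz_advance.
  exists (advance c (Ordinal lt_x) :: s); split=> //=; last by rewrite le_p.
  by rewrite advance_step.
- case=> _ /= c_final _; have: flatten (rest c) = [::].
    apply/eqP/negPn/negP => ne; have: has predT (flatten (rest c)).
      by move: ne; case: flatten.
    case/hasP=> t; rewrite mem_rest => /existsP[l /hasP[b]].
    by rewrite c_final tnth_mktuple drop_size.
  by move=> e; rewrite e in sz_c.
case=> /= /andP[/existsP[j /andP[lt_c /eqP ->]] s_path] s_last /andP[le_p s_all].
exists j; rewrite nth_rest_nil lt_c; split=> //.
  by rewrite -(eq_nopen _ (started_advance lt_c)) -rest_advance // -nb_openE.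
apply: eq_solvable (started_advance lt_c) _; rewrite -rest_advance //.
apply/IH; [exact: le_advance|exact: sz_advance|by exists s].
Qed.

Definition symbols : seq (seq nat) := [seq map plt q | q <- Q].

Lemma flatten_symbols : flatten symbols = map plt (bins Q).
Proof. by rewrite /bins map_flatten. Qed.

Lemma fifo_stack_upE p : fifo_stack_up Q plt p <->
  solvable p (nb_bins Q) (fun=> false) symbols.
Proof.
have rest0 : rest (initial_config k) = symbols.
  rewrite /rest /symbols -[tval Q](map_tnth_enum Q) -map_comp; apply: eq_map => j /=.
  by rewrite tnth_mktuple drop0.
have started0 : started (initial_config k) =1 fun=> false.
  by move=> t; apply/existsP => -[j]; rewrite tnth_mktuple take0.
(* [solvable] tests configurations only after a removal; the initial one passes because nothing is
   open in it. *)
have open0 : nb_open Q plt (initial_config k) = 0.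
  by rewrite nb_openE (eq_nopen _ started0) /nopen /open_set filter_pred0.
have nE : size (flatten (rest (initial_config k))) = nb_bins Q.
  by rewrite rest0 flatten_symbols size_map.
have pathP := solvable_path p _ nE.
rewrite -rest0; split=> [[s /andP[s_path /eqP s_last] /=/andP[_ s_all]]|ok].
  apply: eq_solvable started0 _; apply/pathP; last by exists s.
  by move=> j; rewrite tnth_mktuple.
have {}ok := eq_solvable (fun t => esym (started0 t)) ok.
move: ok => /pathP[|s [s_path s_last s_all]]; first by move=> j; rewrite tnth_mktuple.
by exists s; rewrite /processing /= ?s_path ?s_last ?eqxx // open0.
Qed.

End Configurations.

(** * The program *)

Local Notation "c1 ;; c2" := (Seq c1 c2) (at level 60, right associativity).

Local Notation vE := 0 (only parsing).
Local Notation vone := 1 (only parsing).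
Local Notation vzero := 2 (only parsing).
Local Notation vk := 3 (only parsing).
Local Notation vp := 4 (only parsing).
Local Notation vn := 5 (only parsing).
Local Notation vK := 6 (only parsing).
Local Notation vm := 7 (only parsing).
Local Notation vans := 8 (only parsing).
Local Notation vdone := 9 (only parsing).
Local Notation vf := 10 (only parsing).
Local Notation vok := 11 (only parsing).
Local Notation vdp := 12 (only parsing).
Local Notation vcnt := 13 (only parsing).
Local Notation vfound := 14 (only parsing).
Local Notation vx := 15 (only parsing).
Local Notation vt := 16 (only parsing).
Local Notation vc := 17 (only parsing).
Local Notation ve := 18 (only parsing).
Local Notation vaddr := 19 (only parsing).
Local Notation vcarry := 20 (only parsing).

Local Notation aStart := 0 (only parsing).
Local Notation aEnd := 1 (only parsing).
Local Notation aCur := 2 (only parsing).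
Local Notation aDigit := 3 (only parsing).
Local Notation aStarted := 4 (only parsing).
Local Notation aRem := 5 (only parsing).
Local Notation aTot := 6 (only parsing).
Local Notation aBin := 7 (only parsing).

(** The arrays begin where the input ends, and this address must be known before any array access;
    hence a separate pass that hops over the blocks. [vzero] is never assigned and keeps its initial
    value 0. *)
Definition prog_scan : cmd :=
  Cst vone 1;; In vk vzero;; In vp vone;; Add vE vone vone;;
  While vx vk (In vt vE;; Add vE vE vt;; Add vE vE vone;; Add vx vx vone).

(** Only nonempty sequences receive an interval, which makes [vK] at most n. *)
Definition prog_copy : cmd :=
  Add vaddr vone vone;; Cst vx 0;;
  While vx vk (
    In vt vaddr;; Add vaddr vaddr vone;;
    If vzero vt
      (St aStart vK vn;; Add ve vn vt;; St aEnd vK ve;; Add vK vK vone;;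
       While vn ve (In vt vaddr;; St aBin vn vt;; Add vn vn vone;;
                    Add vaddr vaddr vone))
      Skip;;
    Add vx vx vone).

Definition prog_count : cmd :=
  Cst vx 0;;
  While vx vn (
    Ld vt aBin vx;; Ld vc aTot vt;; Add ve vc vone;; St aTot vt ve;;
    Add vx vx vone;; If vzero vc Skip (Add vm vm vone)).

(** The tables indexed by symbols are restored through the bins, several times for a repeated
    symbol: this costs O(n) however large the symbols are. *)
Definition prog_reset : cmd :=
  Cst vx 0;;
  While vx vn (
    Ld vt aBin vx;; Ld vc aTot vt;; St aRem vt vc;; St aStarted vt vzero;;
    Add vx vx vone);;
  Cst vx 0;;
  While vx vK (Ld vc aStart vx;; St aCur vx vc;; Add vx vx vone).

(** [vfound] equal to [vK] means that no first bin is of a started pallet. A hit leaves the loop by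
    setting [vx] to [vK], which the last increment turns into K + 1. *)
Definition prog_find : cmd :=
  Add vfound vK vzero;; Cst vx 0;;
  While vx vK (
    Ld vc aCur vx;; Ld ve aEnd vx;;
    If vc ve
      (Ld vt aBin vc;; Ld ve aStarted vt;;
       If vzero ve (Add vfound vx vzero;; Add vx vK vzero) Skip)
      Skip;;
    Add vx vx vone).

Definition prog_choose : cmd :=
  If vfound vK Skip
    (If vdp vm
       (Ld vfound aDigit vdp;; Add vdp vdp vone;; Ld vc aCur vfound;;
        Ld ve aEnd vfound;; If vc ve Skip (Cst vok 0))
       (Cst vok 0)).

Definition prog_open : cmd :=
  Ld vc aCur vfound;; Ld vt aBin vc;; Add vc vc vone;; St aCur vfound vc;;
  Ld ve aStarted vt;; St aStarted vt vone;;
  If vzero ve Skip (Add vcnt vcnt vone).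

Definition prog_close : cmd :=
  Ld ve aRem vt;; Sub ve ve vone;; St aRem vt ve;;
  If vzero ve Skip (Sub vcnt vcnt vone).

(** The limit is tested after both updates, when [vcnt] is again the count of a configuration. *)
Definition prog_remove : cmd :=
  prog_open;; prog_close;; If vp vcnt (Cst vok 0) Skip.

Definition prog_greedy : cmd :=
  Add vf vn vzero;; Cst vok 1;; Cst vdp 0;; Cst vcnt 0;;
  While vzero vf (
    prog_find;; prog_choose;; If vzero vok prog_remove Skip;;
    If vzero vok (Sub vf vf vone) (Cst vf 0)).

(** An odometer with its least significant digit first. A carry still set at the end means that all
    digits have wrapped around. *)
Definition prog_incr : cmd :=
  Cst vx 0;; Cst vcarry 1;;
  While vx vm (
    Ld ve aDigit vx;; Add ve ve vone;;
    If ve vK (St aDigit vx ve;; Cst vcarry 0;; Add vx vm vzero)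
             (St aDigit vx vzero;; Add vx vx vone)).

Definition prog_main : cmd :=
  While vdone vone (
    prog_reset;; prog_greedy;;
    If vzero vok (Cst vans 1;; Cst vdone 1)
      (prog_incr;; If vzero vcarry (Cst vdone 1) Skip)).

Definition prog_fifo : cmd := prog_scan;; prog_copy;; prog_count;; prog_main.

(** * Layout of the input in blocks *)

Definition enc (L : seq (seq nat)) : seq nat := flatten [seq size q :: q | q <- L].

Definition input (p : nat) (L : seq (seq nat)) : seq nat := size L :: p :: enc L.

Lemma enc_take L x : x < size L ->
  enc L = enc (take x L) ++ size (nth [::] L x) :: nth [::] L x ++ enc (drop x.+1 L).
Proof.
move=> lt_x; rewrite -{1}(cat_take_drop x L) (drop_nth [::] lt_x).
by rewrite /enc map_cat flatten_cat.
Qed.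

Lemma size_enc_take L x : x < size L ->
  size (enc (take x.+1 L)) = size (enc (take x L)) + (size (nth [::] L x)).+1.
Proof.
by move=> lt_x; rewrite (take_nth [::] lt_x) /enc map_rcons flatten_rcons size_cat.
Qed.

Lemma find_take (T : Type) (x0 : T) (a : pred T) (s : seq T) x : x < size s ->
  ~~ has a (take x s) -> a (nth x0 s x) -> find a s = x.
Proof.
move=> lt_x no_a ax; rewrite -(cat_take_drop x s) find_cat (negPf no_a).
by rewrite (drop_nth x0 lt_x) /= ax addn0 size_takel // ltnW.
Qed.

(** * Vectors of choices as numbers in base k *)

Definition value (k m : nat) (D : nat -> nat) : nat := \sum_(i < m) D i * k ^ i.

Lemma value_lt k m D : (forall j, j < m -> D j < k) -> value k m D < k ^ m.
Proof.
elim: m => [|m IH] ltD; first by rewrite /value big_ord0.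
rewrite /value big_ord_recr /= expnS.
have lt_m : value k m D < k ^ m by apply: IH => j lt_j; apply/ltD/ltnW.
apply: leq_trans (_ : (D m).+1 * k ^ m <= _); last by rewrite leq_mul2r ltD ?orbT.
by rewrite mulSn ltn_add2r.
Qed.

Lemma value_inj k m D D' :
    (forall j, j < m -> D j < k) -> (forall j, j < m -> D' j < k) ->
    value k m D = value k m D' ->
  forall j, j < m -> D j = D' j.
Proof.
elim: m => // m IH ltD ltD'; rewrite /value !big_ord_recr /=.
rewrite -/(value k m D) -/(value k m D').
have ltDm j : j < m -> D j < k by move=> lt_j; apply/ltD/ltnW.
have ltDm' j : j < m -> D' j < k by move=> lt_j; apply/ltD'/ltnW.
have lt_v := value_lt ltDm; have lt_v' := value_lt ltDm'.
have X0 : 0 < k ^ m by apply: leq_ltn_trans lt_v.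
move=> eqv.
have eqm : D m = D' m.
  have := congr1 (fun a => a %/ k ^ m) eqv.
  by rewrite /= ![value _ _ _ + _]addnC !divnMDl // !divn_small // !addn0.
move: eqv; rewrite eqm => /addIn eqv j; rewrite ltnS leq_eqVlt => /orP[/eqP->//|].
exact: IH.
Qed.

Lemma value_update k m D x v : x < m ->
  value k m (update D x v) + D x * k ^ x = value k m D + v * k ^ x.
Proof.
move=> lt_x; pose i0 := Ordinal lt_x.
rewrite /value (bigD1 i0) //= (bigD1 i0 (F := fun i : 'I_m => D i * k ^ i)) //=.
rewrite /update eqxx (eq_bigr (fun i : 'I_m => D i * k ^ i)); first by lia.
by move=> i; rewrite -val_eqE /= => /negPf ->.
Qed.

(** * Correctness and cost of the program, stage by stage *)

Section Program.

Variables (p : nat) (LL : seq (seq nat)) (w : seq nat).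
Hypothesis wE : w = input p LL.

Let syms := flatten LL.
Let n := size syms.
Let F := filter nonempty LL.
Let K := size F.
Let m := size (undup syms).

(* Past [prog_copy], the bins form one array and a sequence is an interval of
   it, so that a configuration is a vector of left ends. *)
Definition slice c e : seq nat := take (e - c) (drop c syms).

Lemma slice_nil c e : e <= c -> slice c e = [::].
Proof. by move=> le_e; rewrite /slice (eqP le_e) take0. Qed.

Lemma slice_cons c e : c < e -> e <= n -> slice c e = nth 0 syms c :: slice c.+1 e.
Proof.
move=> lt_c le_e; rewrite /slice (drop_nth 0) ?(leq_trans lt_c) //.
by rewrite -(subnSK lt_c).
Qed.

Lemma input_nth x : x < size LL ->
  nth 0 w (2 + size (enc (take x LL))) = size (nth [::] LL x).
Proof.
by move=> lt_x; rewrite wE /input /= (enc_take lt_x) nth_cat ltnn subnn.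
Qed.

Lemma input_nthS x y : x < size LL -> y < size (nth [::] LL x) ->
  nth 0 w (2 + size (enc (take x LL)) + y.+1) = nth 0 (nth [::] LL x) y.
Proof.
move=> lt_x lt_y; rewrite wE /input /= (enc_take lt_x) nth_cat.
by rewrite ltnNge leq_addr /= addKn /= nth_cat lt_y.
Qed.

Lemma size_input x : x < size LL ->
  2 + size (enc (take x LL)) + size (nth [::] LL x) < size w.
Proof.
by move=> lt_x; rewrite wE /= (enc_take lt_x) size_cat /= size_cat; lia.
Qed.

Lemma symsE x : x < size LL -> syms
  = flatten (take x LL) ++ nth [::] LL x ++ flatten (drop x.+1 LL).
Proof.
move=> lt_x; rewrite /syms -{1}(cat_take_drop x LL) (drop_nth [::] lt_x).
by rewrite flatten_cat.
Qed.

Lemma syms_nth x y : x < size LL -> y < size (nth [::] LL x) ->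
  nth 0 syms (size (flatten (take x LL)) + y) = nth 0 (nth [::] LL x) y.
Proof.
move=> lt_x lt_y; rewrite (symsE lt_x).
by rewrite nth_cat ltnNge leq_addr /= addKn nth_cat lt_y.
Qed.

Lemma slice_nth x : x < size LL ->
  let N := size (flatten (take x LL)) in
  slice N (N + size (nth [::] LL x)) = nth [::] LL x.
Proof.
move=> lt_x /=; rewrite /slice addKn (symsE lt_x) drop_size_cat //.
by rewrite take_size_cat.
Qed.

Lemma size_flatten_take x : x < size LL ->
  size (flatten (take x.+1 LL))
    = size (flatten (take x LL)) + size (nth [::] LL x).
Proof. by move=> lt_x; rewrite (take_nth [::] lt_x) flatten_rcons size_cat. Qed.

Lemma leq_flatten_take x : size (flatten (take x LL)) <= n.
Proof.
by rewrite /n /syms -[in X in _ <= X](cat_take_drop x LL) flatten_cat size_cat leq_addr.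
Qed.

Definition base s : Prop :=
  [/\ var s vone = 1, var s vzero = 0, var s vk = size LL & var s vp = p].

(** The program does not initialise these variables and arrays but relies on their starting at 0.
    The zero digits are the first vector of choices played. *)
Definition fresh s : Prop :=
  [/\ var s vm = 0, var s vans = 0 & var s vdone = 0] /\
  (forall j, arr s aDigit j = 0) /\ (forall j, arr s aTot j = 0).

Definition init_store : store := Store (fun=> 0) (fun _ _ => 0).

Lemma scan_correct :
  ev w prog_scan init_store (6 + 6 * size LL) (fun _ s =>
    [/\ base s, fresh s & [/\ var s vE = size w, var s vn = 0 & var s vK = 0]]).
Proof.
rewrite /prog_scan.
do 2!ev_step; ev_step; apply: ev_in; first (by rewrite wE); ev_step; apply: ev_in; first (by rewrite wE); do 2!ev_step.
apply: (@ev_while _ (fun r s => [/\ base s, fresh s,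
   [/\ var s vn = 0, var s vK = 0 & r + var s vx = size LL]
   & var s vE = 2 + size (enc (take (var s vx) LL))]) _ 4 _ _ _ (size LL)).
- move=> r s [bs fs [n0 K0 rx] sE]; case: (bs) => o z sk sp.
  rewrite sk => lt_x; have lt_in := size_input lt_x.
  ev_step; apply: ev_in; first by rewrite sE; apply: leq_ltn_trans lt_in; rewrite leq_addr.
  repeat ev_step.
  exists r.-1; first by lia.
  split=> //.
    by split=> //; rewrite /= /update /=; lia.
  rewrite /= /update /= sE input_nth // o !addn1 size_enc_take //; lia.
- move=> r s [bs fs [n0 K0 rx] sE] le_x; split=> //; split=> //.
  by rewrite wE sE take_oversize //; case: bs => _ _ <- _.
- by split=> //; first (by rewrite /base /= /update /= wE); rewrite /= /update /= ?addn0 ?take0.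
- lia.
Qed.

Definition seqs_at s (L : seq (seq nat)) : Prop :=
  [/\ var s vK = size L,
      forall x, x < size L ->
        [/\ arr s aStart x <= arr s aEnd x, arr s aEnd x <= n
          & nth [::] L x = slice (arr s aStart x) (arr s aEnd x)]
    & forall y, y < var s vn -> arr s aBin y = nth 0 syms y].

(** Each sequence is charged for n copied bins instead of its own length. The resulting term in k n
    is harmless, being at most n^2 k^m once there is a bin. *)
Lemma copy_correct s :
    [/\ base s, fresh s & [/\ var s vE = size w, var s vn = 0 & var s vK = 0]] ->
  ev w prog_copy s (4 + size LL * (30 + 12 * n)) (fun _ s =>
    [/\ base s, fresh s, var s vE = size w, var s vn = n & seqs_at s F]).
Proof.
move=> [bs fs [sE sn sK]]; rewrite /prog_copy; do 4!ev_step.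
apply: (@ev_while _ (fun r s => [/\ base s, fresh s, var s vE = size w,
    [/\ var s vn = size (flatten (take (var s vx) LL)), r + var s vx = size LL
      & var s vaddr = 2 + size (enc (take (var s vx) LL))]
   & seqs_at s (filter nonempty (take (var s vx) LL))]) _ (28 + 12 * n)
   _ _ _ (size LL)).
- move=> {bs fs sE sn sK} r {}s [bs fs sE [sn rx sa] ss].
  case: (bs) => o z sk sp; rewrite sk => lt_x.
  have lt_in := size_input lt_x; have [sK s_seq s_bin] := ss.
  have le_n := leq_flatten_take (var s vx).+1; rewrite size_flatten_take // in le_n.
  ev_step; apply: ev_in; first by rewrite sa; apply: leq_ltn_trans lt_in; rewrite leq_addr.
  ev_step; ev_step; rewrite /= /update /= sa input_nth //.
  remember (var s vx) as x eqn:ex in *; remember (nth [::] LL x) as q eqn:eq_q in *.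
  apply: (@ev_cut _ (fun s' => [/\ base s', fresh s', var s' vE = size w,
     [/\ var s' vn = size (flatten (take x.+1 LL)), var s' vx = x
      & var s' vaddr = 2 + size (enc (take x.+1 LL))]
     & seqs_at s' (filter nonempty (take x.+1 LL))]) _ _ _ _ _ (25 + 12 * n) 1).
  + apply: ev_if; rewrite /= /update /= z => q_size.
    * do 8!ev_step; rewrite /= /update /= sn sK o.
      have eF : filter nonempty (take x.+1 LL) = rcons (filter nonempty (take x LL)) q.
        rewrite (take_nth [::] lt_x) filter_rcons -eq_q /nonempty -size_eq0.
        by case: (size q) q_size.
      rewrite eF; set F0 := filter _ _ in sK s_seq ss *.
      set N := size _ in sn le_n *.
      (* The input address and the bin index advance together, which is written as an equation of
         sums to avoid subtraction. The 3 counts the cells of k and p and the length cell of the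
         block. *)
      apply: (@ev_while _ (fun r s' => [/\ base s', fresh s', var s' vE = size w,
          seqs_at s' (rcons F0 q)
        & [/\ var s' vx = x, var s' ve = N + size q, N <= var s' vn,
             r + var s' vn = N + size q
           & var s' vaddr + N = 3 + size (enc (take x LL)) + var s' vn]])
        _ 10 _ _ _ (size q)).
      -- move=> {ex bs fs sE sn rx sa ss o z sk sp sK s_seq s_bin} r' {}s.
         move=> [bs fs sE ss [sx se le_N rn sa]] lt_n.
         case: (bs) => o z sk sp; case: (ss) => sK s_seq s_bin.
         have sa' : var s vaddr = 2 + size (enc (take x LL)) + (var s vn - N).+1 by lia.
         have lt_y : var s vn - N < size q by lia.
         ev_step; apply: ev_in; first by rewrite sa'; lia.
         repeat ev_step; rewrite /= /update /= sa'.
         exists r'.-1; first by lia.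
         split=> //; last by rewrite /= /update /=; split=> //; lia.
         split=> // y; rewrite /= /update /= o addn1 ltnS leq_eqVlt.
         case: eqP => [-> _|_ /s_bin //].
         rewrite input_nthS -?eq_q // eq_q -syms_nth -?eq_q //; congr nth; lia.
      -- move=> r' s' [bs' fs' sE' ss' [sx se le_N rn sa']] le_n'.
         split=> //; rewrite size_flatten_take // size_enc_take // -eq_q; split=> //; lia.
      -- split=> //; last by split; rewrite /= /update /=; lia.
         split.
         ++ by rewrite /= /update /= size_rcons addn1.
         ++ move=> y; rewrite size_rcons ltnS leq_eqVlt /= /update /= nth_rcons.
            case: eqP => [-> _|_ /= lt_y]; last by rewrite lt_y; apply: s_seq.
            rewrite ltnn leq_addr; split=> //.
            by rewrite /N eq_q slice_nth.
         ++ by move=> y; rewrite /= /update /=; apply: s_bin.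
      -- lia.
    * apply: ev_skip.
      have q0 : size q = 0 by lia.
      have eF : filter nonempty (take x.+1 LL) = filter nonempty (take x LL).
        by rewrite (take_nth [::] lt_x) filter_rcons -eq_q (size0nil q0).
      rewrite eF; split=> //; rewrite /= /update /=; split=> //.
        by rewrite sn size_flatten_take // -eq_q q0 addn0.
      by rewrite size_enc_take // -eq_q q0 o; lia.
  + move=> s' [bs' fs' sE' [sn' rx' sa'] ss']; ev_step.
    case: (bs') => o' _ _ _.
    exists r.-1; first by lia.
    have ex' : var s' vx + var s' vone = x.+1 by rewrite rx' o' addn1.
    split=> //; first by rewrite /= /update /= ex'; split=> //; lia.
    by move: ss'; rewrite -ex'.
  + lia.
- move=> {bs fs sE sn sK} r {}s [bs fs sE [sn rx sa] ss] le_x.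
  case: (bs) => o z sk sp; move: sn ss; rewrite take_oversize; last by rewrite -sk.
  by [].
- case: (bs) => o _ _ _; split=> //; rewrite /= /update /= take0; first by rewrite addn0 o sn.
  by split=> // y; rewrite /= /update /= sn.
- lia.
Qed.

Definition glob s : Prop :=
  [/\ var s vone = 1, var s vzero = 0 & var s vp = p] /\
  [/\ var s vE = size w, var s vn = n, var s vm = m, seqs_at s F
    & forall t, arr s aTot t = count_mem t syms].

Lemma size_undup_rcons (t : nat) s :
  size (undup (rcons s t)) = (t \notin s) + size (undup s).
Proof.
rewrite (perm_size (perm_undup (mem_rcons s t))) /=.
by case: (t \in s).
Qed.

Lemma count_correct s :
    [/\ base s, fresh s, var s vE = size w, var s vn = n & seqs_at s F] ->
  ev w prog_count s (4 + 29 * n) (fun _ s =>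
    [/\ glob s, forall j, arr s aDigit j = 0, var s vans = 0 & var s vdone = 0]).
Proof.
move=> [bs [[sm sans sdone] [dig tot]] sE sn ss]; rewrite /prog_count; do 2!ev_step.
apply: (@ev_while _ (fun r s => [/\ [/\ base s, var s vE = size w, var s vn = n & seqs_at s F],
    forall j, arr s aDigit j = 0, var s vans = 0, var s vdone = 0
   & [/\ r + var s vx = n, var s vm = size (undup (take (var s vx) syms))
       & forall t, arr s aTot t = count_mem t (take (var s vx) syms)]])
   _ 27 _ _ _ n).
- move=> {bs sm sans sdone dig tot sE sn ss} r {}s.
  move=> [[bs sE sn ss] dig sans sdone [rx sm tot]].
  case: (bs) => o z _ _; case: (ss) => _ _ s_bin lt_x.
  do 10!ev_step; rewrite /= /update /= s_bin //.
  rewrite sn in lt_x.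
  set t := nth 0 syms _; rewrite tot.
  have eq_t : take (var s vx).+1 syms = rcons (take (var s vx) syms) t.
    exact: take_nth.
  have tot' : forall c, c = count_mem t (take (var s vx) syms) ->
      forall t', (if t' == t then c + 1 else arr s aTot t')
        = count_mem t' (take (var s vx).+1 syms).
    move=> c -> t'; rewrite eq_t -cats1 count_cat /= addn0 eq_sym.
    by rewrite tot; case: eqP => [->|_]; rewrite ?addn0.
  rewrite o.
  have mem_t : (0 < count_mem t (take (var s vx) syms)) = (t \in take (var s vx) syms).
    by rewrite -has_count has_pred1.
  apply: ev_if; rewrite /= /update /= z => c_lt; ev_step; (exists r.-1; first by lia).
    split=> //; split; rewrite /= /update /=; first by lia.
      by rewrite [var s vx + 1]addn1 eq_t size_undup_rcons -mem_t c_lt.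
    by move=> t'; rewrite [var s vx + 1]addn1; apply: tot'.
  split=> //; split; rewrite /= /update /=; first by lia.
    by rewrite [var s vx + 1]addn1 eq_t size_undup_rcons -mem_t ltnNge c_lt sm o addn1.
  by move=> t'; rewrite [var s vx + 1]addn1; apply: tot'.
- move=> {bs sm sans sdone dig tot sE sn ss} r {}s.
  move=> [[bs sE sn ss] dig sans sdone [rx sm tot]]; rewrite sn => le_x.
  case: (bs) => o z _ sp; split=> //; split=> //; split=> //.
    by rewrite sm take_oversize.
  by move=> t; rewrite tot take_oversize.
- split=> //; split; rewrite /= /update /= ?addn0 ?take0 //.
- lia.
Qed.

(** * Playing one vector of choices *)

Definition env (D : nat -> nat) s : Prop :=
  [/\ glob s, forall j, arr s aDigit j = D j, var s vans = 0
    & var s vdone = 0].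

Lemma reset_correct D s : env D s ->
  ev w prog_reset s (6 + (31 * n + 17 * K)) (fun _ s =>
    [/\ env D s, forall t, t \in syms ->
           arr s aStarted t = 0 /\ arr s aRem t = count_mem t syms
      & forall x, x < K -> arr s aCur x = arr s aStart x]).
Proof.
move=> ss; rewrite /prog_reset; do 2!ev_step.
set P := fun s => env D s /\ forall t, t \in syms ->
           arr s aStarted t = 0 /\ arr s aRem t = count_mem t syms.
apply: (@ev_cut _ P _ _ _ _ _ (2 + 31 * n) (3 + 17 * K)).
- apply: (@ev_while _ (fun r s => [/\ env D s, r + var s vx = n &
   forall t, t \in take (var s vx) syms ->
     arr s aStarted t = 0 /\ arr s aRem t = count_mem t syms]) _ 29 _ _ _ n).
  + move=> {ss} r {}s [ss rx s_t] lt_x; have [gs _ _ _] := ss.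
    have [[o z _] [sE sn _ [_ _ s_bin] tot]] := gs.
    have eq_t := s_bin _ lt_x; rewrite -/syms in eq_t; rewrite sn in lt_x.
    repeat ev_step; rewrite /= /update /= eq_t.
    exists r.-1; first by lia.
    split=> //; first by rewrite /= /update /=; lia.
    move=> t; rewrite /= /update /= o addn1 (take_nth 0 lt_x) mem_rcons in_cons z tot.
    by case: eqVneq => [->|_ /s_t].
  + move=> {ss} r {}s [ss rx s_t]; have [gs _ _ _] := ss.
    have [_ [_ sn _ _ _]] := gs; rewrite sn => le_n.
    by split=> // t t_in; apply: s_t; rewrite take_oversize.
  + by split; rewrite // /= /update /= ?addn0 // => t; rewrite take0.
  + by lia.
- move=> {ss} {}s [ss s_t]; do 2!ev_step.
  apply: (@ev_while _ (fun r s => [/\ P s, r + var s vx = K &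
    forall x, x < var s vx -> arr s aCur x = arr s aStart x]) _ 15 _ _ _ K).
  + move=> {ss s_t} r {}s [ss rx s_x] lt_x; have [[gs _ _ _] _] := ss.
    have [[o z _] [sE sn _ [sK _ _] _]] := gs; rewrite sK in lt_x.
    repeat ev_step; rewrite /= /update /=.
    exists r.-1; first by lia.
    split=> //; first by rewrite /= /update /=; lia.
    move=> x; rewrite /= /update /= o addn1 ltnS leq_eqVlt.
    by case: eqVneq => [->|_ /s_x].
  + move=> {ss s_t} r {}s [[ss s_t] rx s_x]; have [gs _ _ _] := ss.
    have [_ [_ _ _ [sK _ _] _]] := gs; rewrite sK => le_K.
    by split=> // x lt_x; apply: s_x; apply: leq_trans le_K.
  + by split; rewrite // /= /update /= addn0.
  + by lia.
- by lia.
Qed.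

(** Ties the memory to the abstract state of [greedy]. Emptied sequences stay in [L], so that digits
    keep naming the same sequences. The tables are described only at symbols of the input, the
    entries that [prog_reset] restores. *)
Definition simst S L s : Prop :=
  [/\ var s vcnt = nopen S L, size L = K, {subset flatten L <= syms},
      forall x, x < K -> nth [::] L x = slice (arr s aCur x) (arr s aEnd x)
    & forall t, t \in syms ->
        (0 < arr s aStarted t) = S t /\ arr s aRem t = count_mem t (flatten L)].

Definition ctl ok f dp s : Prop :=
  [/\ var s vok = ok, var s vf = f & var s vdp = dp].

Lemma find_correct D S L ok f dp s : env D s -> simst S L s -> ctl ok f dp s ->
  ev w prog_find s (4 + 40 * K) (fun _ s =>
    [/\ env D s, simst S L s, ctl ok f dp s
      & var s vfound = find (started_head S) L]).
Proof.
move=> ss sim cs; have [gs _ _ _] := ss.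
have [[_ z _] [_ _ _ [sK _ _] _]] := gs; rewrite /prog_find; do 4!ev_step.
apply: (@ev_while _ (fun r s => [/\ env D s, simst S L s, ctl ok f dp s,
    K - var s vx <= r
  & (var s vx <= K /\ var s vfound = K /\ ~~ has (started_head S) (take (var s vx) L))
    \/ (K <= var s vx /\ var s vfound = find (started_head S) L)])
  _ 38 _ _ _ K).
- move=> {ss sim cs gs sK z} r {}s [ss sim cs le_r no_x] lt_x; have [gs _ _ _] := ss.
  have [[o z _] [sE sn _ [sK s_seq s_bin] _]] := gs; rewrite sK in lt_x.
  have [scnt sL sub s_sl s_t] := sim.
  case: no_x => [[_ [sf no_x]]|[]]; last by rewrite leqNgt lt_x.
  have [le_c le_n _] := s_seq _ lt_x.
  have Lx := s_sl _ lt_x; have lt_xL : var s vx < size L by rewrite sL.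
  (* Common end of an iteration that passes over a sequence, whether its interval is empty or its
     first bin belongs to a pallet not started. *)
  have next s' : env D s' -> simst S L s' -> ctl ok f dp s' ->
      var s' vx = var s vx -> var s' vfound = K ->
      started_head S (nth [::] L (var s vx)) = false ->
      ev w (Add vx vx vone) s' 1 (fun _ s => exists2 r', r' < r & [/\ env D s, simst S L s, ctl ok f dp s,
        K - var s vx <= r'
      & (var s vx <= K /\ var s vfound = K /\ ~~ has (started_head S) (take (var s vx) L))
        \/ (K <= var s vx /\ var s vfound = find (started_head S) L)]).
    move=> ss' sim' cs' ex ef no_s; ev_step; have [[[o' _ _] _] _ _ _] := ss'.
    have eS : var s' vx + var s' vone = (var s vx).+1 by rewrite ex o' addn1.
    exists r.-1; first by lia.
    split=> //; first by rewrite /= /update /= eS; lia.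
    left; rewrite /= /update /= eS; split=> //; split=> //.
    by rewrite (take_nth [::] lt_xL) has_rcons no_s.
  have weak s' T P : ev w (Add vx vx vone) s' 1 (fun _ => P) -> 0 < T ->
      ev w (Add vx vx vone) s' T (fun _ => P).
    by move=> e lt; apply: ev_weaken e _ lt.
  do 5!ev_step; rewrite /= /update /=.
  apply: ev_if; rewrite /= /update /= => lt_c; last first.
    ev_step; apply: weak => //; apply: next => //.
    by rewrite Lx slice_nil.
  have eq_t : arr s aBin (arr s aCur (var s vx)) = head_at L (var s vx).
    by rewrite /head_at Lx slice_cons // s_bin // sn (leq_trans lt_c le_n).
  do 4!ev_step; rewrite /= /update /= eq_t.
  have t_in : head_at L (var s vx) \in syms.
    apply: sub; apply/flattenP; exists (nth [::] L (var s vx)).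
      exact: mem_nth.
    by rewrite /head_at Lx slice_cons // inE eqxx.
  have [es _] := s_t _ t_in.
  have eq_s : started_head S (nth [::] L (var s vx)) = S (head_at L (var s vx)).
    by rewrite /head_at Lx slice_cons.
  apply: ev_if; rewrite /= /update /= z => started.
    repeat ev_step; exists r.-1; first by lia.
    split=> //; first by rewrite /= /update /=; lia.
    right; rewrite /= /update /= sK; split; first by lia.
    by rewrite z addn0; symmetry; apply: (@find_take _ [::]) => //; rewrite eq_s -es.
  ev_step; apply: weak => //; apply: next => //.
  by rewrite eq_s -es ltnNge started.
- move=> {ss sim cs gs sK z} r {}s [ss sim cs le_r no_x]; have [gs _ _ _] := ss.
  have [_ [_ _ _ [sK _ _] _]] := gs; rewrite sK => le_x; split=> //.
  case: no_x => [[_ [-> no_x]]|[]//].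
  have [_ sL _ _ _] := sim.
  by rewrite take_oversize ?sL // in no_x; rewrite hasNfind ?sL.
- split; rewrite // /= /update /= ?subn0 //; left; split=> //.
  by rewrite take0 sK z addn0.
- by lia.
Qed.

Lemma choose_correct D S L f dp s : (forall j, j < m -> D j < K) ->
    env D s -> simst S L s -> ctl 1 f.+1 dp s ->
    var s vfound = find (started_head S) L ->
  let G := greedy p f.+1 (drop dp (mkseq D m)) S L in
  ev w prog_choose s 30 (fun _ s =>
    (exists x, [/\ env D s, simst S L s, ctl 1 f.+1 (var s vdp) s,
        var s vfound = x /\ nth [::] L x != [::]
      & G = (nopen (start S (head_at L x)) (pop L x) <= p) &&
          greedy p f (drop (var s vdp) (mkseq D m)) (start S (head_at L x)) (pop L x)])
    \/ [/\ env D s, var s vok = 0 & G = false]).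
Proof.
move=> HD ss sim cs sf G; have [gs dig _ _] := ss.
have [[o z _] [sE sn sm [sK s_seq _] _]] := gs; have [sok sf' sdp] := cs.
have [scnt sL sub s_sl s_t] := sim.
apply: ev_if; rewrite sf sK => lt_x.
  apply: ev_skip; left; exists (find (started_head S) L).
  have lt_x' : find (started_head S) L < size L by rewrite sL.
  have [Lx _] := find_started lt_x'.
  by split=> //; rewrite /G /= lt_x' sdp.
have no_x : (find (started_head S) L < size L) = false by rewrite sL ltnNge lt_x.
have szD : size (mkseq D m) = m by rewrite size_mkseq.
apply: ev_if; rewrite sdp sm -/m => lt_d; last first.
  ev_step; right; split=> //; rewrite /G /= no_x drop_oversize // szD //.
have eG : G = [&& nth [::] L (D dp) != [::],
    nopen (start S (head_at L (D dp))) (pop L (D dp)) <= p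
  & greedy p f (drop dp.+1 (mkseq D m)) (start S (head_at L (D dp))) (pop L (D dp))].
  by rewrite /G (drop_nth 0) ?szD // nth_mkseq //= no_x.
have sDx := HD _ lt_d; have [le_c le_n _] := s_seq _ sDx.
do 8!ev_step; rewrite /= /update /= sdp dig o addn1.
apply: ev_if; rewrite /= /update /= => lt_c; ev_step.
  left; exists (D dp); have Lx : nth [::] L (D dp) != [::].
    by rewrite s_sl // slice_cons.
  by split=> //; rewrite eG Lx.
right; split=> //.
by rewrite eG s_sl // slice_nil.
Qed.

Lemma open_correct D S L f dp s x :
    env D s -> simst S L s -> ctl 1 f dp s ->
    var s vfound = x -> nth [::] L x != [::] ->
  ev w prog_open s 40 (fun _ s => [/\ env D s, ctl 1 f dp s,
     var s vt = head_at L x, var s vcnt = nopen S L + ~~ S (head_at L x) &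
     (forall y, y < K -> nth [::] (pop L x) y = slice (arr s aCur y) (arr s aEnd y)) /\
     (forall t, t \in syms -> (0 < arr s aStarted t) = start S (head_at L x) t
        /\ arr s aRem t = count_mem t (flatten L))]).
Proof.
move=> ss sim cs sf Lx; have [gs _ _ _] := ss.
have [[o z _] [sE sn _ [_ s_seq s_bin] _]] := gs.
have [scnt sL sub s_sl s_t] := sim.
have lt_x : x < K by rewrite -sL; apply: nth_nil_lt.
have [le_c le_n _] := s_seq _ lt_x.
have lt_c : arr s aCur x < arr s aEnd x.
  by rewrite ltnNge; apply: contra Lx => le_e; rewrite s_sl // slice_nil.
have eq_t : arr s aBin (arr s aCur x) = head_at L x.
  by rewrite /head_at s_sl // slice_cons // s_bin // sn (leq_trans lt_c le_n).
have t_in : head_at L x \in syms by apply: sub; rewrite (mem_pop _ Lx) eqxx.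
have [es _] := s_t _ t_in.
have slE y : y < K -> nth [::] (pop L x) y
    = slice (if y == x then arr s aCur x + 1 else arr s aCur y) (arr s aEnd y).
  move=> lt_y; rewrite nth_pop; case: eqVneq => [->|_]; last exact: s_sl.
  by rewrite s_sl // slice_cons // addn1.
have stE t : t \in syms ->
    (0 < (if t == head_at L x then 1 else arr s aStarted t)) = start S (head_at L x) t
    /\ arr s aRem t = count_mem t (flatten L).
  by move=> t_s; have [e1 ->] := s_t _ t_s; rewrite /start; case: eqP.
rewrite /prog_open; do 12!ev_step; rewrite /= /update /= sf eq_t o.
apply: ev_if; rewrite /= /update /= z => started; ev_step.
  by split=> //; rewrite /= /update /= scnt -es started addn0.
split=> //; rewrite /= /update /= scnt o -es.
by rewrite -leqNgt in started *; rewrite started.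
Qed.

Lemma close_correct D S L f dp s x :
    env D s -> ctl 1 f dp s -> var s vt = head_at L x ->
    nth [::] L x != [::] -> size L = K -> {subset flatten L <= syms} ->
    var s vcnt = nopen S L + ~~ S (head_at L x) ->
    (forall y, y < K -> nth [::] (pop L x) y = slice (arr s aCur y) (arr s aEnd y)) ->
    (forall t, t \in syms -> (0 < arr s aStarted t) = start S (head_at L x) t
        /\ arr s aRem t = count_mem t (flatten L)) ->
  ev w prog_close s 20 (fun _ s => [/\ env D s, ctl 1 f dp s
    & simst (start S (head_at L x)) (pop L x) s]).
Proof.
move=> ss cs st Lx sL sub scnt s_sl s_t; have [gs _ _ _] := ss.
have [[o z _] [sE sn _ [_ s_seq s_bin] _]] := gs.
have t_in : head_at L x \in flatten L by rewrite (mem_pop _ Lx) eqxx.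
have [_ er] := s_t _ (sub _ t_in).
have count_pop t : count_mem t (flatten L)
    = (head_at L x == t) + count_mem t (flatten (pop L x)).
  by move/permP: (perm_pop Lx) => ->.
have er' : arr s aRem (head_at L x) - 1 = count_mem (head_at L x) (flatten (pop L x)).
  by rewrite er count_pop eqxx add1n subn1.
have remE t : t \in syms -> (0 < arr s aStarted t) = start S (head_at L x) t /\
    (if t == head_at L x then count_mem (head_at L x) (flatten (pop L x))
     else arr s aRem t) = count_mem t (flatten (pop L x)).
  move=> t_s; have [-> ->] := s_t _ t_s; split=> //.
  by rewrite count_pop eq_sym; case: eqP => [->|].
have memE : (0 < count_mem (head_at L x) (flatten (pop L x)))
    = (head_at L x \in flatten (pop L x)) by rewrite -has_count has_pred1.
have nopenE := nopen_pop S Lx.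
have sub' : {subset flatten (pop L x) <= syms}.
  by move=> t /(sub_pop Lx)/sub.
have sL' : size (pop L x) = K by rewrite size_pop.
rewrite /prog_close; do 6!ev_step; rewrite /= /update /= st o er'.
apply: ev_if; rewrite /= /update /= z => last_t; ev_step.
  split=> //; split=> //.
  by rewrite /= /update /= nopenE scnt -memE last_t subn0.
split=> //; split=> //.
by rewrite /= /update /= nopenE scnt o -memE ltnNge last_t.
Qed.

Lemma greedy_correct D s : (forall j, j < m -> D j < K) -> env D s ->
    (forall t, t \in syms -> arr s aStarted t = 0 /\ arr s aRem t = count_mem t syms) ->
    (forall x, x < K -> arr s aCur x = arr s aStart x) ->
  ev w prog_greedy s (6 + n * (112 + 40 * K)) (fun _ s =>
    env D s /\ var s vok = greedy p n (mkseq D m) (fun=> false) F).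
Proof.
move=> HD ss s_t s_x; have [gs _ _ _] := ss.
have [[o z _] [sE sn _ [_ s_seq _] _]] := gs.
set G := greedy _ _ _ _ _.
rewrite /prog_greedy; do 8!ev_step; rewrite /= /update /=.
apply: (@ev_while _ (fun r s => env D s /\
   ((exists S L, [/\ simst S L s, ctl 1 r (var s vdp) s
      & G = greedy p r (drop (var s vdp) (mkseq D m)) S L])
   \/ [/\ var s vok = 0, var s vf = 0 & G = false])) _ (110 + 40 * K) _ _ _ n).
- move=> {ss s_t s_x gs o z sE sn s_seq} r {}s [ss cs] lt_f; have [gs _ _ _] := ss.
  have [[o z _] _] := gs; rewrite z in lt_f.
  case: cs => [[S [L [sim cs eG]]]|[_ f0 _]]; last by rewrite f0 in lt_f.
  have [_ sf sdp] := cs; case: r => [|r] in cs eG sf *; first by rewrite sf in lt_f.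
  apply: ev_cut (find_correct ss sim cs) _ (_ : _ + 105 <= _); last by lia.
  move=> {lt_f sf sdp o z gs ss sim} s1 [ss sim cs' sfound].
  apply: ev_cut (choose_correct HD ss sim cs' sfound) _ (_ : _ + 75 <= _); last by lia.
  rewrite -eG => {}s1 {ss sim sfound} {}cs'.
  apply: (@ev_cut _ (fun s => env D s /\
     ((exists S L, [/\ simst S L s, ctl 1 r.+1 (var s vdp) s
        & G = greedy p r (drop (var s vdp) (mkseq D m)) S L])
     \/ [/\ var s vok = 0 & G = false])) _ _ _ _ _ 70 5); last by lia.
    case: cs' => [[x [ss sim cs' [sfound Lx] eG']]|[ss ok0 G0]].
      have [gs _ _ _] := ss; have [[_ z sp] _] := gs; have [ok1 _ _] := cs'.
      apply: ev_if; rewrite z ok1 // => _.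
      have [_ sL sub _ _] := sim.
      apply: ev_cut (open_correct ss sim cs' sfound Lx) _ (_ : _ + 29 <= _); last by [].
      move=> s2 [ss2 cs2 st scnt [s_sl s_t]].
      apply: ev_cut (close_correct ss2 cs2 st Lx sL sub scnt s_sl s_t) _ (_ : _ + 9 <= _); last by [].
      move=> s3 [ss3 cs3 sim3]; have [gs3 _ _ _] := ss3; have [[_ z3 sp3] _] := gs3.
      have [cnt3 _ _ _ _] := sim3; have [_ _ sdp3] := cs3.
      apply: ev_if; rewrite sp3 cnt3 => le_p; ev_step; split=> //.
        by right; split=> //; rewrite eG' leqNgt le_p.
      left; exists (start S (head_at L x)), (pop L x); rewrite sdp3; split=> //.
      by rewrite eG' le_p.
    have [gs _ _ _] := ss; have [[_ z _] _] := gs.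
    apply: ev_if; rewrite z ok0 // => _; apply: ev_skip; split=> //; by right.
  move=> {cs'} s2 [ss2 cs2]; have [gs2 _ _ _] := ss2; have [[o z _] _] := gs2.
  case: cs2 => [[S' [L' [sim2 cs2 eG2]]]|[ok0 G0]].
    have [ok1 sf _] := cs2.
    apply: ev_if; rewrite z ok1 // => _; ev_step; exists r => //; split=> //.
    left; exists S', L'; split=> //.
    by split=> //; rewrite /= /update /= sf o subn1.
  apply: ev_if; rewrite z ok0 // => _; ev_step; exists r => //; split=> //.
  by right.
- move=> {ss s_t s_x gs o z sE sn s_seq} r {}s [ss cs]; have [gs _ _ _] := ss.
  have [[o z _] _] := gs; rewrite z leqn0 => /eqP f0; split=> //.
  case: cs => [[S [L [_ [-> sf _] ->]]]|[-> _ ->]] //.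
  by move: sf; rewrite f0 => <-.
- split=> //; left; exists (fun=> false), F; split=> //.
  + split=> //.
    * by rewrite /= /update /= /nopen /open_set filter_pred0.
    * by rewrite flatten_nonempty.
    * by move=> x lt_x; rewrite /= /update /= s_x //; case: (s_seq _ lt_x).
    * by move=> t t_s; rewrite /= /update /= flatten_nonempty; case: (s_t _ t_s) => -> ->.
  + by split=> //; rewrite /= /update /= z addn0.
  + by rewrite /= /update /= drop0.
- by lia.
Qed.

Lemma incr_correct D s : (forall j, j < m -> D j < K) -> env D s ->
  ev w prog_incr s (4 + m * 22) (fun _ s => exists D',
    [/\ forall j, j < m -> D' j < K, env D' s
      & var s vcarry = 0 /\ value K m D' = (value K m D).+1 \/
        var s vcarry = 1 /\ K ^ m <= (value K m D).+1]).
Proof.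
move=> ltD ss; rewrite /prog_incr; do 4!ev_step.
apply: (@ev_while _ (fun r s => exists D',
   [/\ forall j, j < m -> D' j < K, env D' s, m - var s vx <= r &
     [/\ var s vcarry = 1, var s vx <= m
       & (value K m D).+1 = value K m D' + K ^ var s vx]
     \/ [/\ var s vcarry = 0, m <= var s vx & value K m D' = (value K m D).+1]])
  _ 20 _ _ _ m).
- move=> {ss} r {}s [D' [ltD' ss le_r cs]] lt_x; have [gs dig sans sdone] := ss.
  have [[o z sp] [sE sn sm [sK s_seq s_bin] tot]] := gs; rewrite sm -/m in lt_x.
  case: cs => [[carry1 _ eqv]|[_ le_x _]]; last by rewrite leqNgt lt_x in le_x.
  set x := var s vx in lt_x le_r eqv.
  have lt_d := ltD' _ lt_x.
  do 4!ev_step; rewrite /= /update /= dig o addn1 -/x.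
  have upd v : forall j, (if j == x then v else arr s aDigit j) = update D' x v j.
    by move=> j; rewrite /update dig.
  have updK v : v < K -> forall j, j < m -> update D' x v j < K.
    by move=> lt_v j lt_j; rewrite /update; case: eqP => // _; apply: ltD'.
  apply: ev_if; rewrite /= /update /= sK => lt_e; repeat ev_step; rewrite /= /update /=.
    exists r.-1; first by lia.
    exists (update D' x (D' x).+1); split.
    + exact: updK.
    + by split=> //; apply: upd.
    + by rewrite /= /update /= sm z addn0 -/m subnn.
    + right; split=> //; first by rewrite /= /update /= sm z addn0.
      have := value_update K D' (D' x).+1 lt_x; rewrite mulSn; lia.
  exists r.-1; first by lia.
  exists (update D' x 0); split.
  + by apply: updK; apply: leq_ltn_trans lt_d.
  + by rewrite z; split=> //; apply: upd.
  + by rewrite /= /update /= o addn1 -/x; lia.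
  + have eS : var s vx + var s vone = x.+1 by rewrite o addn1.
    left; split=> //; first by rewrite /= /update /= eS.
    suff : (value K m D).+1
      = value K m (update D' x 0) + K ^ (var s vx + var s vone) by [].
    rewrite eS; have := value_update K D' 0 lt_x; rewrite mul0n addn0 eqv expnS => <-.
    have -> : K = (D' x).+1 by apply/eqP; rewrite eqn_leq lt_e lt_d.
    by rewrite mulSn; lia.
- move=> {ss} r {}s [D' [ltD' ss le_r cs]]; have [gs _ _ _] := ss.
  have [_ [_ _ sm _ _]] := gs; rewrite sm -/m => le_x.
  exists D'; split=> //; case: cs => [[c1 le_x' ->]|[c0 _ ->]]; last by left.
  right; split=> //; have -> : var s vx = m by apply/eqP; rewrite eqn_leq le_x le_x'.
  exact: leq_addl.
- exists D; split=> //; first by rewrite /= /update /= subn0.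
  by left; rewrite /= /update /= addn1.
- by lia.
Qed.

Definition winning (D : nat -> nat) : bool :=
  greedy p n (mkseq D m) (fun=> false) F.

Lemma main_correct s :
    [/\ glob s, forall j, arr s aDigit j = 0, var s vans = 0 & var s vdone = 0] ->
  ev w prog_main s (2 + K ^ m * (40 + (31 * n + 17 * K + n * (112 + 40 * K) + m * 22)))
    (fun _ s => var s vzero = 0 /\
      ((exists2 D, forall j, j < m -> D j < K & winning D) /\ var s vans = 1 \/
       (forall D, (forall j, j < m -> D j < K) -> ~~ winning D) /\ var s vans = 0)).
Proof.
move=> ss; have m_gt0 : 0 < m -> 0 < K.
  rewrite /m /K /F /syms -(flatten_nonempty LL).
  by case: (filter _ _).
apply: (@ev_while _ (fun r s => [/\ var s vone = 1, var s vzero = 0 &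
  (exists D, [/\ forall j, j < m -> D j < K, env D s, K ^ m - value K m D <= r
     & forall D', (forall j, j < m -> D' j < K) ->
         value K m D' < value K m D -> ~~ winning D'])
  \/ var s vdone = 1 /\
      ((exists2 D, forall j, j < m -> D j < K & winning D) /\ var s vans = 1 \/
       (forall D, (forall j, j < m -> D j < K) -> ~~ winning D) /\ var s vans = 0)])
  _ (38 + (31 * n + 17 * K + n * (112 + 40 * K) + m * 22)) _ _ _ (K ^ m)).
- move=> {ss} r {}s [o z cs] lt_done; rewrite o in lt_done.
  case: cs => [[D [ltD ss le_r lose]]|[done1 _]]; last by rewrite done1 in lt_done.
  apply: ev_cut (reset_correct ss)
    _ (_ : _ + (22 + n * (112 + 40 * K) + m * 22) <= _); last by lia.
  move=> {o z ss lt_done} s1 [ss s_t s_x].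
  apply: ev_cut (greedy_correct ltD ss s_t s_x) _ (_ : _ + (16 + m * 22) <= _);
    last by lia.
  rewrite -/(winning D) => {s_t s_x ss} s2 [ss sok].
  have [gs dig sans sdone] := ss; have [[o z _] _] := gs.
  have lt_v := value_lt ltD.
  apply: ev_if; rewrite z sok => win.
    do 3!ev_step; exists r.-1; first by lia.
    split=> //; right; split=> //; left; split=> //.
    by exists D => //; move: win; case: (winning D).
  apply: (@ev_cut _ _ _ _ _ _ _ _ 4 (incr_correct ltD ss)); last by lia.
  have lose' D' : (forall j, j < m -> D' j < K) ->
      value K m D' < (value K m D).+1 -> ~~ winning D'.
    move=> ltD'; rewrite ltnS leq_eqVlt => /orP[/eqP eqv|]; last exact: lose.
    move: win; rewrite leqn0 eqb0; congr (~~ greedy _ _ _ _ _).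
    apply/eq_in_map => j; rewrite mem_iota => /andP[_ lt_j].
    by rewrite (value_inj ltD' ltD eqv).
  move=> {o z gs dig sans sdone ss sok} s3 [D' [ltD' ss cs]].
  have [gs dig sans sdone] := ss; have [[o z _] _] := gs.
  apply: ev_if; rewrite z => carry; ev_step; (exists r.-1; first by lia).
    case: cs => [[c0 _]|[_ le_v]]; first by rewrite c0 in carry.
    split=> //; right; split=> //; right; split=> // D'' ltD''.
    by apply: lose' => //; apply: leq_trans le_v; apply: value_lt.
  case: cs => [[_ eqv]|[c1 _]]; last by rewrite c1 in carry.
  split=> //; left; exists D'; split=> //; first by rewrite eqv; lia.
  by rewrite eqv.
- move=> {ss} r {}s [-> z [[D [_ [_ _ _ done0] _ _]]|[]//]].
  by rewrite done0.
- case: (ss) => [[[o z _] _] dig sans sdone]; split=> //; left.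
  exists (fun=> 0); split=> //; last 2 first.
    exact: leq_subr.
  by move=> D' _; rewrite [X in _ < X]big1.
  by move=> j lt_j; apply: m_gt0; apply: leq_ltn_trans lt_j.
- by rewrite addnC leq_add2l leq_mul2l; apply/orP; right; lia.
Qed.

Lemma winningP :
  (exists2 D, forall j, j < m -> D j < K & winning D) <->
  solvable p n (fun=> false) F.
Proof.
split=> [[D _ /greedy_sound //]|ok].
have open0 : nopen (fun=> false) F = 0 by rewrite /nopen /open_set filter_pred0.
have fresh_m : nfresh (fun=> false) F = m.
  by rewrite /nfresh /nopen /open_set filter_predT flatten_nonempty.
have [|||ds [sz_ds ds_lt ds_ok]] := greedy_complete (u := m) ok.
- by rewrite open0.
- by rewrite fresh_m.
- by rewrite /m /syms -(flatten_nonempty LL) -/F; case: (F).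
exists (nth 0 ds) => [j lt_j|]; last by rewrite /winning -sz_ds mkseq_nth.
by move/all_nthP: ds_lt => /(_ 0 j); rewrite sz_ds; apply.
Qed.

Lemma fifo_correct :
  ev w prog_fifo init_store
    (18 + (6 * size LL + size LL * (30 + 12 * n) + 29 * n +
     K ^ m * (40 + (31 * n + 17 * K + n * (112 + 40 * K) + m * 22))))
    (fun _ s => var s vzero = 0 /\
      (solvable p n (fun=> false) F /\ var s vans = 1 \/
       ~ solvable p n (fun=> false) F /\ var s vans = 0)).
Proof.
set Tm := K ^ m * _.
apply: ev_cut scan_correct _
  (_ : _ + (12 + (size LL * (30 + 12 * n) + 29 * n + Tm)) <= _); last by lia.
move=> s1 s1P; apply: ev_cut (copy_correct s1P) _
  (_ : _ + (8 + (29 * n + Tm)) <= _); last by lia.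
move=> s2 s2P; apply: ev_cut (count_correct s2P) _ (_ : _ + (2 + Tm) <= _);
  last by lia.
move=> s3 s3P; apply: ev_weaken (main_correct s3P) _ (leqnn _).
move=> s4 [z [[win ans]|[lose ans]]]; split=> //.
  by left; split=> //; apply/winningP.
right; split=> // /winningP[D ltD win].
by have := lose D ltD; rewrite win.
Qed.

End Program.

Definition fifo_program : program := compile 0 prog_fifo ++ [:: RAdd 0 vans.+2 vzero.+2].

Lemma iter_halted P s t : halted P s -> iter t (machine_step P) s = s.
Proof. by move=> hs; elim: t => //= t ->; rewrite /machine_step hs. Qed.

Lemma rep_init w : rep w init_store (fun=> 0) (nth 0 w).
Proof.
by split=> // c j _; rewrite nth_default // -addnA leq_addr.
Qed.

Lemma compile_decides c w (A : Prop) T0 T :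
    ev w c init_store T0 (fun _ s => var s vzero = 0 /\
      (A /\ var s vans = 1 \/ ~ A /\ var s vans = 0)) ->
    T0 < T ->
  decides_within (compile 0 c ++ [:: RAdd 0 vans.+2 vzero.+2]) w A T.
Proof.
move=> [t [s [ex le_t [z ans]]]] lt_T; set P := _ ++ _.
have code : code_at P 0 P by exists [::], [::]; rewrite cats0.
have [code1 code2] := code_at_cat code.
have [R [M [run_t [vE _ _]]]] := compile_correct ex code1 (rep_init _).
have run_t1 : run P w t.+1 = State (size (compile 0 c)).+1
    (update R 0 (R vans.+2 + R vzero.+2)) M.
  by rewrite /run iterS run_t (machine_step_at _ _ code2).
have halt_t : halted P (run P w t.+1) by rewrite run_t1 /halted size_cat addn1.
have run_T : run P w T = run P w t.+1.
  rewrite -(subnK (leq_ltn_trans le_t lt_T)) {1}/run iterD; exact: iter_halted.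
rewrite /decides_within run_T; split=> //; rewrite run_t1 /=.
rewrite [update _ _ _ _]/= !vE z addn0.
by case: ans => -[Aok ->]; [left | right].
Qed.

Lemma fifo_program_correct p LL (A : Prop) T :
  let n := size (flatten LL) in
  let K := size (filter nonempty LL) in
  let m := size (undup (flatten LL)) in
  (A <-> solvable p n (fun=> false) LL) ->
  19 + (6 * size LL + size LL * (30 + 12 * n) + 29 * n +
     K ^ m * (40 + (31 * n + 17 * K + n * (112 + 40 * K) + m * 22))) <= T ->
  decides_within fifo_program (input p LL) A T.
Proof.
move=> n K m AP le_T; apply: compile_decides le_T.
apply: ev_weaken (fifo_correct (erefl (input p LL))) _ (leqnn _) => s [z ans].
split=> //; case: ans => -[ok ans]; [left | right]; split=> //.
  exact/AP/solvable_nonempty.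
by move=> /AP/solvable_nonempty.
Qed.

Lemma encodeE (B : eqType) k (Q : k.-tuple (seq B)) plt p :
  encode Q plt p = input p (symbols Q plt).
Proof.
rewrite /encode /input /enc /symbols size_map size_tuple -map_comp.
by congr [:: _, _ & flatten _]; apply: eq_map => q /=; rewrite size_map.
Qed.

Lemma size_nonempty LL : size (filter nonempty LL) <= size (flatten LL).
Proof. by elim: LL => //= -[|t q] LL IH //=; rewrite size_cat; lia. Qed.

Lemma cost_bound k n K m : 0 < n -> 0 < K -> 0 < m -> K <= n -> m <= n -> K <= k ->
  19 + (6 * k + k * (30 + 12 * n) + 29 * n +
    K ^ m * (40 + (31 * n + 17 * K + n * (112 + 40 * K) + m * 22)))
  <= 358 * (n ^ 2 * k ^ m).
Proof.
move=> n_gt0 K_gt0 m_gt0 le_Kn le_mn le_Kk.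
have k_gt0 : 0 < k by apply: leq_trans le_Kk.
have X_gt0 : 0 < k ^ m by rewrite expn_gt0 k_gt0.
have le_kX : k <= k ^ m by rewrite -{1}[k]expn1 leq_pexp2l.
have le_KX : K ^ m <= k ^ m by rewrite leq_exp2r.
have le_nN : n <= n ^ 2 by rewrite -{1}[n]expn1 leq_pexp2l.
have le_NY : n ^ 2 <= n ^ 2 * k ^ m by rewrite leq_pmulr.
have le_XY : k ^ m <= n ^ 2 * k ^ m by rewrite leq_pmull ?expn_gt0 ?n_gt0.
have le_knY : n * k <= n ^ 2 * k ^ m by apply: leq_mul.
have le_nKN : n * K <= n ^ 2 by rewrite leq_mul2l le_Kn orbT.
have le_body : 40 + (31 * n + 17 * K + n * (112 + 40 * K) + m * 22) <= 262 * n ^ 2.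
  by rewrite mulnDr [n * (40 * K)]mulnCA; lia.
have := leq_mul le_KX le_body; rewrite [k ^ m * _]mulnCA [k ^ m * n ^ 2]mulnC.
rewrite [k * (30 + _)]mulnDr [k * (12 * n)]mulnCA [k * n]mulnC; lia.
Qed.

Theorem theorem5 :
  exists (P : program) (C : nat),
    forall (B : eqType) (k : nat) (Q : k.-tuple (seq B)) (plt : B -> nat)
      (p : nat),
    fifo_instance Q plt p ->
    (exists t : nat,
        decides_within P (encode Q plt p) (fifo_stack_up Q plt p) t) /\
    (0 < nb_bins Q ->
      decides_within P (encode Q plt p) (fifo_stack_up Q plt p)
        (C * (nb_bins Q ^ 2 * k ^ nb_pallets Q plt))).
Proof.
exists fifo_program, 358 => B k Q plt p _.
have nE : nb_bins Q = size (flatten (symbols Q plt)).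
  by rewrite flatten_symbols size_map.
have mE : nb_pallets Q plt = size (undup (flatten (symbols Q plt))).
  by rewrite flatten_symbols.
have AP := fifo_stack_upE Q plt p; rewrite nE in AP.
rewrite encodeE; split; first by eexists; apply: fifo_program_correct AP (leqnn _).
rewrite mE nE => n_gt0; apply: fifo_program_correct AP _.
rewrite size_map size_tuple; apply: cost_bound => //.
- by move: n_gt0; rewrite -flatten_nonempty; case: (filter _ _).
- case: (flatten _) n_gt0 => // t s _.
  by have := mem_head t s; rewrite -mem_undup; case: (undup _).
- exact: size_nonempty.
- exact: size_undup.
- by rewrite size_filter -[k in _ <= k](size_tuple Q) -(size_map (map plt)) count_size.
Qed.
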